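(* Let $D\subseteq\mathbb{Z}^2$ be finite and let $b,a$ be non-negative integers such that $g=f_D-(b-a)$ has no line polynomial factors. Then the set $\mathcal{S}(D,b,a)$ of all $(D,b,a)$-coverings is finite, and one can effectively construct all of its elements.
   Context: Write $X^{\vec u}=x^{u_1}y^{u_2}$ and $f_D=\sum_{\vec u\in D}X^{-\vec u}$. A line polynomial is a Laurent polynomial in $\mathbb{C}[x^{\pm1},y^{\pm1}]$ whose support has at least two points, all on one line; a line polynomial factor is a divisor that is a line polynomial. A $(D,b,a)$-covering is $c\in\{0,1\}^{\mathbb{Z}^2}$ such that for every $\vec u$, the number of $\vec v\in\vec u+D$ with $c_{\vec v}=1$ is $a$ if $c_{\vec u}=0$ and $b$ if $c_{\vec u}=1$. The set $\mathcal{S}(D,b,a)$ is a subshift of finite type. ''Effectively construct'' means an algorithm outputs finite descriptions of all elements; in finite subshifts every element is invariant under two linearly independent translations, so it is described by a finite periodic block. *)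

(* Defs.v *)
(* MathComp world; [R] is any model of the reals and [R[i]] the complex
   numbers over it.  Points of Z^2 are the elements of the additive group
   [int * int]. *)
From HB Require Import structures.
From mathcomp Require Import all_boot all_order all_algebra.
From mathcomp Require Import finmap.
From mathcomp Require Import complex.
From mathcomp Require Import boolp classical_sets functions cardinality reals.

Set Implicit Arguments.
Unset Strict Implicit.
Unset Printing Implicit Defensive.

Import Order.TTheory GRing.Theory Num.Theory.

Local Open Scope fset_scope.
Local Open Scope ring_scope.

(* Laurent polynomials in two variables over C, as finitely supported families
   of coefficients: [f u] is the coefficient of X^u.  (The monoid algebras of
   monalg require monomials without inverses, hence do not apply.) *)

Definition laurent (R : realType) := {fsfun int * int -> R[i] with 0}.

Definition laurent_const (R : realType) (z : R[i]) : laurent R :=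
  [fsfun w in [fset (0 : int * int)] => z].

Definition laurent_sub (R : realType) (f g : laurent R) : laurent R :=
  [fsfun w in finsupp f `|` finsupp g => f w - g w].

Definition laurent_mul (R : realType) (f g : laurent R) : laurent R :=
  [fsfun w in [fset u + v | u in finsupp f, v in finsupp g] =>
    \sum_(u <- finsupp f) f u * g (w - u)].

Definition laurent_dvd (R : realType) (h f : laurent R) : Prop :=
  exists q : laurent R, f = laurent_mul h q.

(* Lines may be taken with integer coefficients, since a line through two
   points of Z^2 has an integer equation. *)
Definition on_a_line (A : {fset int * int}) : Prop :=
  exists m n k : int, (m, n) != (0, 0) /\
    {in A, forall u, m * u.1 + n * u.2 = k}.

Definition line_polynomial (R : realType) (h : laurent R) : Prop :=
  (2 <= #|` finsupp h|)%N /\ on_a_line (finsupp h).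

Definition has_line_factor (R : realType) (f : laurent R) : Prop :=
  exists h : laurent R, line_polynomial h /\ laurent_dvd h f.

Definition fpoly (R : realType) (D : {fset int * int}) : laurent R :=
  [fsfun w in [fset - u | u in D] => 1].

Definition gpoly (R : realType) (D : {fset int * int}) (b a : nat) :
    laurent R :=
  laurent_sub (fpoly R D) (laurent_const (b%:R - a%:R)).

Definition configuration := int * int -> bool.

Definition is_covering (D : {fset int * int}) (b a : nat)
    (c : configuration) : Prop :=
  forall u, #|` [fset v in [fset u + d | d in D] | c v]| = if c u then b else a.

Definition coverings (D : {fset int * int}) (b a : nat) : set configuration :=
  [set c | is_covering D b a c]%classic.

(* A rectangular, nonempty array of bits given by its rows, and the
   configuration obtained by repeating it periodically. *)

Definition is_block (B : seq (seq bool)) : bool :=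
  [&& B != [::], head [::] B != [::] &
      all (fun r => size r == size (head [::] B)) B].

Definition periodic_configuration (B : seq (seq bool)) : configuration :=
  fun u =>
    let r := nth [::] B `|(u.1 %% (size B)%:Z)%Z|%N in
    nth false r `|(u.2 %% (size r)%:Z)%Z|%N.

(* Model of computation: the WHILE language on binary trees, in point-free
   form.  A program maps trees to trees, and [Leaf] stands for "false" in
   tests. *)

Inductive tree : Type :=
| Leaf
| Node of tree & tree.

Definition hd_tree (t : tree) := if t is Node l _ then l else Leaf.
Definition tl_tree (t : tree) := if t is Node _ r then r else Leaf.

Inductive prog : Type :=
| PId
| PLeaf
| PHd
| PTl
| PNode of prog & prog
| PSeq of prog & prog
| PIf of prog & prog & prog
| PWhile of prog & prog.

(* [eval p x y]: on input [x], [p] halts with output [y].  [PSeq p q] runs [p]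
   first; [PWhile t p] iterates [p] until [t] yields [Leaf]. *)
Inductive eval : prog -> tree -> tree -> Prop :=
| EId x : eval PId x x
| ELeaf x : eval PLeaf x Leaf
| EHd x : eval PHd x (hd_tree x)
| ETl x : eval PTl x (tl_tree x)
| ENode p q x y z :
    eval p x y -> eval q x z -> eval (PNode p q) x (Node y z)
| ESeq p q x y z : eval p x y -> eval q y z -> eval (PSeq p q) x z
| EIfTrue t p q x l r y :
    eval t x (Node l r) -> eval p x y -> eval (PIf t p q) x y
| EIfFalse t p q x y : eval t x Leaf -> eval q x y -> eval (PIf t p q) x y
| EWhileStop t p x : eval t x Leaf -> eval (PWhile t p) x x
| EWhileStep t p x l r y z :
    eval t x (Node l r) -> eval p x y -> eval (PWhile t p) y z ->
    eval (PWhile t p) x z.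

Lemma eval_deterministic p x y z : eval p x y -> eval p x z -> y = z.
Proof.
move=> H; elim: H z => {p x y}.
- by move=> x z H; inversion H.
- by move=> x z H; inversion H.
- by move=> x z H; inversion H.
- by move=> x z H; inversion H.
- move=> p q x y1 y2 _ IH1 _ IH2 z H; inversion H; subst.
  by congr Node; [exact: IH1 | exact: IH2].
- move=> p q x y1 y2 _ IH1 _ IH2 z H; inversion H; subst.
  by apply: IH2; rewrite (IH1 y).
- move=> t p q x l r y _ IH1 _ IH2 z H; inversion H; subst; first exact: IH2.
  by have := IH1 Leaf; move=> /(_ ltac:(assumption)).
- move=> t p q x y _ IH1 _ IH2 z H; inversion H; subst; last exact: IH2.
  by have := IH1 (Node l r); move=> /(_ ltac:(assumption)).
- move=> t p x _ IH z H; inversion H; subst => //.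
  by have := IH (Node l r); move=> /(_ ltac:(assumption)).
- move=> t p x l r y y' _ IH1 _ IH2 _ IH3 z H; inversion H; subst.
    by have := IH1 Leaf; move=> /(_ ltac:(assumption)).
  by apply: IH3; rewrite (IH2 y0).
Qed.

Definition enc_bool (x : bool) : tree := if x then Node Leaf Leaf else Leaf.

Definition enc_nat (n : nat) : tree := iter n (Node Leaf) Leaf.

(* Sign and absolute value. *)
Definition enc_int (m : int) : tree := Node (enc_bool (m < 0)) (enc_nat `|m|%N).

Definition enc_point (u : int * int) : tree := Node (enc_int u.1) (enc_int u.2).

Definition enc_seq (T : Type) (enc : T -> tree) (s : seq T) : tree :=
  foldr (fun x t => Node (enc x) t) Leaf s.

Definition enc_input (s : seq (int * int)) (b a : nat) : tree :=
  Node (enc_seq enc_point s) (Node (enc_nat b) (enc_nat a)).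

Definition enc_output (L : seq (seq (seq bool))) : tree :=
  enc_seq (enc_seq (enc_seq enc_bool)) L.

(* The promise on [(D, b, a)] is the predicate [P].  A single program must work
   for all inputs, and for every listing [s] of the finite set [D]. *)
Definition coverings_effectively_constructible
    (P : {fset int * int} -> nat -> nat -> Prop) : Prop :=
  exists p : prog, forall (D : {fset int * int}) (b a : nat), P D b a ->
    forall s : seq (int * int), perm_eq s D ->
    exists L : seq (seq (seq bool)),
      [/\ eval p (enc_input s b a) (enc_output L), all is_block L &
          coverings D b a = [set periodic_configuration B | B in [set` L]]%classic].

(* Main.v *)
(* Finiteness.  The difference [e] of two coverings takes its values in
   {-1, 0, 1} and is annihilated by [g].  Reducing modulo a large prime [p],
   where g(X)^p = g(X^p), shows that g(X^p) annihilates [e] modulo [p], hence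
   exactly because the values are small; so g(X^(1+kr)) annihilates [e] for a
   fixed [r > 0] and all [k].  A Vandermonde elimination among these relations
   yields, for [v0] in the support of [g], the annihilator
   prod_(v <> v0) (X^(r v0) - X^(r v)), a product of factors X^w - z with [w]
   primitive, up to monomials.  A configuration killed by [g] and by X^w - z
   obeys a one-dimensional linear recurrence, which is nontrivial because
   X^w - z does not divide [g]; hence its values at finitely many points
   determine it.  The same follows for a product of such factors, so that all
   coverings are determined by their restrictions to one finite set.

   Construction.  Finiteness makes all coverings periodic with a common period,
   and by compactness this period is already forced on all patterns that are
   locally admissible on a large enough square.  Searching for such a square
   therefore terminates, and a successful search certifies that the coverings
   are exactly the periodic extensions of its admissible periodic patterns. *)
Require Import Defs.
From mathcomp Require Import all_boot all_order all_algebra.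
From mathcomp Require Import finmap.
From mathcomp Require Import complex.
From mathcomp Require Import boolp classical_sets functions cardinality reals.
From mathcomp Require Import filter finfield zify ring.

Set Implicit Arguments.
Unset Strict Implicit.
Unset Printing Implicit Defensive.

Import Order.TTheory GRing.Theory Num.Theory.

Local Open Scope fset_scope.
Local Open Scope ring_scope.

(** * Dilation of annihilators *)

Section FreshmanDream.
Variable V : zmodType.
Implicit Types A B : V -> V.

Lemma morph_sum A (I : Type) (s : seq I) (F : I -> V) :
  {morph A : x y / x + y} -> A (\sum_(i <- s) F i) = \sum_(i <- s) A (F i).
Proof.
move=> AD; have A0 : A 0 = 0 by apply: (addrI (A 0)); rewrite -AD !addr0.
by rewrite (big_morph _ AD A0).
Qed.

Lemma morph_muln A n x : {morph A : x y / x + y} -> A (x *+ n) = A x *+ n.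
Proof.
move=> AD; have A0 : A 0 = 0 by apply: (addrI (A 0)); rewrite -AD !addr0.
by elim: n => [|n IHn]; rewrite ?mulr0n // !mulrS AD IHn.
Qed.

Lemma iter_comm A B n x :
  (forall y, A (B y) = B (A y)) -> A (iter n B x) = iter n B (A x).
Proof. by move=> AB; elim: n => //= n IHn; rewrite AB IHn. Qed.

(** The binomial theorem for commuting additive operators, by Pascal's rule. *)
Lemma iterD_comm A B n x :
    {morph A : x y / x + y} -> {morph B : x y / x + y} ->
    (forall y, A (B y) = B (A y)) ->
  iter n (fun y => A y + B y) x =
  \sum_(k < n.+1) iter (n - k) A (iter k B x) *+ 'C(n, k).
Proof.
move=> AD BD AB; elim: n => [|n IHn]; first by rewrite big_ord1.
rewrite iterS IHn (morph_sum _ _ AD) (morph_sum _ _ BD) [RHS]big_ord_recl subn0 bin0 mulr1n.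
under [X in _ = _ + X]eq_bigr do rewrite lift0 subSS binS mulrnDr.
rewrite big_split /= addrA; congr (_ + _).
  rewrite big_ord_recl subn0 morph_muln // bin0 mulr1n; congr (_ + _).
  rewrite [RHS]big_ord_recr /= bin_small // mulr0n addr0.
  apply: eq_bigr => k _; rewrite morph_muln //; congr (_ *+ _).
  by rewrite subnS -iterS prednK // subn_gt0.
apply: eq_bigr => k _; rewrite morph_muln //; congr (_ *+ _).
by rewrite iter_comm // => y.
Qed.

(** The middle binomial coefficients are divisible by [p], hence act as zero on [V]. *)
Lemma iterD_pchar p A B x : prime p -> (forall y : V, y *+ p = 0) ->
    {morph A : x y / x + y} -> {morph B : x y / x + y} ->
    (forall y, A (B y) = B (A y)) ->
  iter p (fun y => A y + B y) x = iter p A x + iter p B x.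
Proof.
move=> p_pr Vp AD BD AB; rewrite iterD_comm //.
case: p p_pr Vp => // p p_pr Vp.
rewrite big_ord_recl big_ord_recr big1 => [|k _].
  by rewrite subn0 bin0 lift0 subnn binn !mulr1n /= add0r.
have /dvdnP[m ->] : (p.+1 %| 'C(p.+1, lift ord0 (widen_ord (leqnSn p) k)))%N.
  by rewrite prime_dvd_bin // lift0 /= ltnS ltn_ord.
by rewrite mulrnA mulrnAC Vp mul0rn.
Qed.

Lemma iter_sum_pchar p (I : Type) (s : seq I) (T : I -> V -> V) x :
    prime p -> (forall y : V, y *+ p = 0) ->
    (forall i, {morph T i : x y / x + y}) ->
    (forall i j y, T i (T j y) = T j (T i y)) ->
  iter p (fun y => \sum_(i <- s) T i y) x = \sum_(i <- s) iter p (T i) x.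
Proof.
move=> p_pr Vp TD TC; elim: s => [|i s IHs].
  rewrite big_nil; case: p p_pr {Vp} => // p _.
  by rewrite iterS big_nil.
rewrite big_cons -IHs -iterD_pchar //.
- by apply: eq_iter => y; rewrite big_cons.
- by move=> y z; rewrite -big_split /=; apply: eq_bigr => j _; rewrite TD.
- by move=> y; rewrite morph_sum //; apply: eq_bigr => j _; rewrite TC.
Qed.

End FreshmanDream.

Lemma fct_mulnE (T : Type) (V : zmodType) (f : T -> V) n x :
  (f *+ n) x = f x *+ n.
Proof. by elim: n => [|n IHn]; rewrite ?mulr0n // !mulrS -IHn. Qed.

Lemma fct_sumE (T I : Type) (V : zmodType) (s : seq I) (f : I -> T -> V) x :
  (\sum_(i <- s) f i) x = \sum_(i <- s) f i x.
Proof.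
by elim: s => [|i s IHs]; rewrite ?big_nil // !big_cons -IHs.
Qed.

(** Reduce modulo [p] and let [T i] be [g i] times translation by [w i]. The sum of the [T i] kills
    [e], so its [p]-th iterate does, and this is the sum of the [iter p (T i)]. By Fermat the [p]-th
    power of [g i] is [g i], so the dilated sum is divisible by [p]; being smaller than [p], it is
    zero. *)
Lemma prime_dilation (I : Type) (s : seq I) (g : I -> int)
    (w : I -> int * int) (e : int * int -> int) (p : nat) :
    prime p ->
    (forall u, \sum_(i <- s) g i * e (u - w i) = 0) ->
    (forall u, `|\sum_(i <- s) g i * e (u - w i *+ p)| < p%:Z) ->
  forall u, \sum_(i <- s) g i * e (u - w i *+ p) = 0.
Proof.
move=> p_pr ge0 small u.
pose T i (f : int * int -> 'F_p) : int * int -> 'F_p :=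
  fun v => (g i)%:~R * f (v - w i).
pose e' : int * int -> 'F_p := fun v => (e v)%:~R.
have pF := pchar_Fp p_pr.
have TD i : {morph T i : x y / x + y}.
  by move=> x y; apply/funext => v; rewrite /T /= mulrDr.
have TC i j y : T i (T j y) = T j (T i y).
  by apply/funext => v; rewrite /T mulrCA addrAC.
have Vp (y : int * int -> 'F_p) : y *+ p = 0.
  apply/funext => v; rewrite fct_mulnE.
  by rewrite -mulr_natr (pcharf0 pF) mulr0.
have Te0 : \sum_(i <- s) T i e' = 0.
  apply/funext => v; rewrite fct_sumE -[RHS]/((0 : int)%:~R) -(ge0 v) rmorph_sum.
  by apply: eq_bigr => i _; rewrite rmorphM.
have iT i n : iter n (T i) e' = fun v => (g i)%:~R ^+ n * e' (v - w i *+ n).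
  elim: n => [|n IHn]; apply/funext => v /=.
    by rewrite mul1r mulr0n subr0.
  by rewrite IHn /T exprS mulrA mulrSr opprD addrA [in LHS]addrAC.
have := iter_sum_pchar s e' p_pr Vp TD TC.
have -> : iter p (fun y => \sum_(i <- s) T i y) e' = 0.
  have iter0 n : iter n.+1 (fun y => \sum_(i <- s) T i y) e' = 0.
    elim: n => [|n IHn]; first exact: Te0.
    rewrite iterS IHn big1 // => i _.
    by apply: (addrI (T i 0)); rewrite -TD !addr0.
  by rewrite -[RHS](iter0 p.-1) prednK // prime_gt0.
move/(congr1 (fun f => f u)); rewrite fct_sumE.
under eq_bigr do rewrite iT.
have Fr (x : 'F_p) : x ^+ p = x by rewrite -{2}[x]expf_card card_Fp.
under eq_bigr do rewrite Fr /e' -rmorphM.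
rewrite -rmorph_sum => /esym/eqP.
rewrite -(dvdz_pcharf pF) => /dvdzP[k] sE; have := small u; rewrite sE.
by rewrite normrM gtr_pMl ?ltz_nat ?prime_gt0 // => k1; have -> : k = 0 by lia.
Qed.

(** Prime factors of [n] are peeled off one at a time. As [e] is bounded by 1, every dilated sum is
    at most the sum of the [|g i|], thus below each of these primes. *)
Lemma dilation (I : Type) (s : seq I) (g : I -> int) (w : I -> int * int)
    (e : int * int -> int) (B n : nat) :
    (forall u, \sum_(i <- s) g i * e (u - w i) = 0) ->
    (forall u, `|e u| <= 1) -> \sum_(i <- s) `|g i| < B%:Z ->
    (0 < n)%N -> (forall p, prime p -> p %| n -> B <= p)%N ->
  forall u, \sum_(i <- s) g i * e (u - w i *+ n) = 0.
Proof.
move=> ge0 e1 gB; elim/ltn_ind: n => n IHn n0 nB.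
have [n1|n_neq1] := eqVneq n 1%N; first by rewrite n1.
have n_gt1 : (1 < n)%N by lia.
have pn := pdiv_dvd n; have p_pr := pdiv_prime n_gt1.
move: (pdiv n) pn p_pr => p pn p_pr; have Bp := nB _ p_pr pn.
have [/dvdnP[m nE] p1] := (pn, prime_gt1 p_pr).
have m0 : (0 < m)%N by case: (m) nE n0 => // ->.
have mn : (m < n)%N by rewrite nE ltn_Pmulr.
have IH u : \sum_(i <- s) g i * e (u - w i *+ m) = 0.
  apply: IHn => // q q_pr qm; apply: nB => //.
  by rewrite nE; apply: dvdn_mulr.
move=> u; rewrite nE; under eq_bigr do rewrite mulrnA.
apply: prime_dilation => // v; apply: le_lt_trans (ler_norm_sum _ _ _) _.
apply: (@le_lt_trans _ _ (\sum_(i <- s) `|g i|)).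
  by apply: ler_sum => i _; rewrite normrM ler_piMr.
by apply: lt_le_trans gB _; rewrite lez_nat.
Qed.

(** The factorial of [B] absorbs all primes below [B], so no such prime divides one plus a multiple
    of it. The exponents form an arithmetic progression, as the elimination below requires. *)
Lemma coprime_dilation (I : Type) (s : seq I) (g : I -> int)
    (w : I -> int * int) (e : int * int -> int) (B k : nat) :
    (forall u, \sum_(i <- s) g i * e (u - w i) = 0) ->
    (forall u, `|e u| <= 1) -> \sum_(i <- s) `|g i| < B%:Z ->
  forall u, \sum_(i <- s) g i * e (u - w i *+ (1 + k * B`!)) = 0.
Proof.
move=> ge0 e1 gB u; apply: (dilation ge0 e1 gB); first by rewrite add1n.
move=> p p_pr; rewrite leqNgt; apply: contraL => pB.
have pd : (p %| k * B`!)%N.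
  by apply: dvdn_mull; rewrite dvdn_fact // prime_gt0 //= ltnW.
rewrite dvdn_addl // dvdn1; apply: contraL p_pr => /eqP->.
by [].
Qed.

(** * Configurations determined by finitely many values *)

Section Annihilators.
Variable F : closedFieldType.
Implicit Types (e : int * int -> F) (a b u v : int * int) (z : F).

(** Multiplication by [X^v] acts as translation by [v], so this is the operator
    [X^o.1.1 - o.2 X^o.1.2]. *)
Definition shift_sub (o : (int * int) * (int * int) * F) e : int * int -> F :=
  fun u => e (u - o.1.1) - o.2 * e (u - o.1.2).

Definition shift_subs (ops : seq ((int * int) * (int * int) * F)) e :=
  foldl (fun e' o => shift_sub o e') e ops.

(** Relation [k + 1] minus [X^(r w i1)] times relation [k] cancels the term of [i1] and replaces
    each other [E i] by [(X^(r w i) - X^(r w i1)) E i]. The result has the same shape with one index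
    fewer, until only [i0] is left. *)
Lemma eliminate (I : Type) (i0 : I) (s : seq I) (w : I -> int * int)
    (E : I -> int * int -> F) (r : nat) :
    (forall k u, \sum_(i <- i0 :: s) E i (u - w i *+ (1 + k * r)) = 0) ->
  forall u,
    shift_subs [seq (w i0 *+ r, w i *+ r, 1) | i <- s] (E i0) u = 0.
Proof.
elim: s E => [|i1 s IHs] E E0 u.
  have := E0 0%N (u + w i0); rewrite big_seq1 mul0n mulr1n addrK.
  by [].
rewrite /shift_subs /=.
apply: (IHs (fun i => shift_sub (w i *+ r, w i1 *+ r, 1) (E i))) => k v.
rewrite /shift_sub /= sumrB -mulr_sumr mul1r.
have split x : \sum_(i <- i0 :: s) E i (x i) =
    \sum_(i <- [:: i0, i1 & s]) E i (x i) - E i1 (x i1).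
  by rewrite !big_cons addrCA [E i1 _ + _]addrC addrK.
rewrite !split.
have -> : \sum_(i <- [:: i0, i1 & s]) E i (v - w i *+ (1 + k * r) - w i *+ r) = 0.
  rewrite -[RHS](E0 k.+1 v); apply: eq_bigr => i _; congr (E i _).
  by rewrite -addrA -opprD -mulrnDr mulSn addnCA addnC.
have -> : \sum_(i <- [:: i0, i1 & s]) E i (v - w i *+ (1 + k * r) - w i1 *+ r) = 0.
  rewrite -[RHS](E0 k (v - w i1 *+ r)); apply: eq_bigr => i _; congr (E i _).
  by rewrite addrAC.
by rewrite subrr.
Qed.

(** It is applied to linear conditions [P], for which it says that the values on [S] determine a
    configuration. *)
Definition finitely_determined (P : (int * int -> F) -> Prop) : Prop :=
  exists S : seq (int * int), forall e, P e ->
    (forall u, u \in S -> e u = 0) -> forall u, e u = 0.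

Section FixedAnnihilator.
Variables (I : Type) (s : seq I) (g : I -> F) (w : I -> int * int).

Definition annihilated e := forall u, \sum_(i <- s) g i * e (u - w i) = 0.

Lemma annihilated_shift_sub o e : annihilated e -> annihilated (shift_sub o e).
Proof.
move=> e0 u; rewrite /shift_sub.
under eq_bigr do rewrite mulrBr mulrCA.
have E v : \sum_(i <- s) g i * e (u - w i - v) = 0.
  by rewrite -[RHS](e0 (u - v)); apply: eq_bigr => i _; rewrite addrAC.
by rewrite sumrB -mulr_sumr !E mulr0 subrr.
Qed.

(** The first factor turns [e] into a configuration still annihilated by [g] and killed by the
    remaining factors. Its values on [S2] are read off from two translates of [S2]; once it
    vanishes, [S1] handles [e] itself. *)
Lemma finitely_determined_shift_subs ops :
    (forall o, o \in ops -> finitely_determined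
      (fun e => annihilated e /\ forall u, shift_sub o e u = 0)) ->
  finitely_determined
    (fun e => annihilated e /\ forall u, shift_subs ops e u = 0).
Proof.
elim: ops => [|o ops IHops] FDo; first by exists [::] => e [_ e0] _.
have [S1 S1P] := FDo o (mem_head _ _).
have [|S2 S2P] := IHops; first by move=> p p_ops; apply: FDo; rewrite inE p_ops orbT.
exists (S1 ++ [seq v - o.1.1 | v <- S2] ++ [seq v - o.1.2 | v <- S2]).
move=> e [ge e0] eS; apply: S1P => [|u uS]; last by apply: eS; rewrite mem_cat uS.
split=> //; apply: S2P => [|u uS].
  by split; [exact: annihilated_shift_sub | exact: e0].
rewrite /shift_sub !eS ?mulr0 ?subrr // !mem_cat.
  by rewrite (map_f (fun v => v - o.1.2) uS) !orbT.
by rewrite (map_f (fun v => v - o.1.1) uS) orbT.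
Qed.

End FixedAnnihilator.

(** The composite of the operators [X^v - z] is the monic polynomial with roots [rs], evaluated at
    [X^v]. *)
Lemma shift_subs_roots v (rs : seq F) (N : nat) e u : (size rs < N)%N ->
  shift_subs [seq (v, 0, z) | z <- rs] e u =
  \sum_(k < N) (\prod_(z <- rs) ('X - z%:P))`_k * e (u - v *+ k).
Proof.
elim: rs N e => [|z rs IHrs] [//|N] e /= sN.
  rewrite big_nil big_ord_recl coef1 mul1r mulr0n subr0 big1 ?addr0 // => i _.
  by rewrite coef1 mul0r.
rewrite -[LHS]/(shift_subs _ (shift_sub (v, 0, z) e) u) (IHrs N) //.
rewrite big_cons mulrBl; under [RHS]eq_bigr do rewrite coefB mulrBl.
rewrite sumrB big_ord_recl coefXM mul0r add0r.
under [X in _ = X - _]eq_bigr do rewrite coefXM lift0 /=.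
rewrite [X in _ = _ - X]big_ord_recr /= coefCM nth_default ?mulr0 ?mul0r ?addr0.
  rewrite -sumrB; apply: eq_bigr => k _; rewrite /shift_sub /= coefCM mulrBr subr0.
  by rewrite mulrSr opprD addrA mulrCA mulrA.
by rewrite size_prod_XsubC.
Qed.

Lemma primitive_multiple u : u != 0 ->
  exists v (d : nat), [/\ (0 < d)%N, coprimez v.1 v.2 & u = v *+ d].
Proof.
case: u => x y; rewrite -[_ == _]/((x == 0) && (y == 0)) => xy0.
have d0 : (0 < gcdn `|x| `|y|)%N by rewrite gcdn_gt0 !absz_gt0; case: eqP xy0.
have [/dvdzP[x' xE] /dvdzP[y' yE]] : (gcdz x y %| x)%Z /\ (gcdz x y %| y)%Z.
  by rewrite dvdz_gcdl dvdz_gcdr.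
exists (x', y'), (gcdn `|x| `|y|); split=> //=.
  have [a [b abE]] := Bezoutz x y; apply/coprimezP; exists (a, b) => /=.
  have g0 : gcdz x y != 0 by rewrite /gcdz; move: d0; lia.
  by apply: (mulIf g0); rewrite mul1r mulrDl -!mulrA -xE -yE.
have mE (k : nat) (a b : int) : (a, b) *+ k = (a *+ k, b *+ k).
  by elim: k => // k IHk; rewrite !mulrS IHk.
rewrite mE; congr pair; rewrite -mulr_natr natz; [exact: xE | exact: yE].
Qed.

(** * One-dimensional linear recurrences *)

Lemma recurrence_forward (J : seq int) (m f : int -> F) (N : nat) :
    uniq J -> J != [::] -> {in J, forall j, m j != 0} ->
    {in J &, forall i j, j - i <= N%:Z} ->
    (forall t, \sum_(j <- J) m j * f (t - j) = 0) ->
    (forall n : nat, (n < N)%N -> f n = 0) ->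
  forall n : nat, f n = 0.
Proof.
move=> uJ J0 mJ JN rec fN.
have [j0 j0J j0min] : exists2 j0, j0 \in J & {in J, forall j, j0 <= j}.
  elim: (J) J0 => // i [|j K] IHK _; first by exists i; rewrite ?mem_head // => k /[!inE]/eqP->.
  have [//|l lK lmin] := IHK; have [il|li] := lerP i l.
    exists i; rewrite ?mem_head // => k; rewrite in_cons => /orP[/eqP-> //|/lmin].
    exact: le_trans.
  exists l; first by rewrite in_cons lK orbT.
  move=> k; rewrite in_cons => /orP[/eqP->|/lmin//].
  exact: ltW.
elim/ltn_ind => n IHn; have [/fN//|Nn] := ltnP n N.
(* At [t = n + j0] the term of the least index [j0] is a nonzero multiple of [f n], and the others
   involve [f] only on [[n - N, n)]. *)
have := rec (n%:Z + j0); rewrite (bigD1_seq j0) //= addrK big1_seq ?addr0.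
  by move=> /eqP; rewrite mulf_eq0 (negPf (mJ _ j0J)) => /eqP.
move=> j /andP[jj0 jJ]; have := JN _ _ j0J jJ; have := j0min _ jJ.
move=> le1 le2; have jE : n%:Z + j0 - j = absz (n%:Z + j0 - j)%R by lia.
by rewrite jE IHn ?mulr0 //; lia.
Qed.

(** Negative arguments are reached by the reflection [t -> N - 1 - t], which preserves the window
    [[0, N)] and negates the indices of the recurrence. *)
Lemma recurrence_unique (J : seq int) (m f : int -> F) (N : nat) :
    uniq J -> J != [::] -> {in J, forall j, m j != 0} ->
    {in J &, forall i j, j - i <= N%:Z} ->
    (forall t, \sum_(j <- J) m j * f (t - j) = 0) ->
    (forall n : nat, (n < N)%N -> f n = 0) ->
  forall t, f t = 0.
Proof.
move=> uJ J0 mJ JN rec fN t.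
case: t => [n|n]; first exact: (recurrence_forward uJ J0 mJ JN rec fN).
pose f' t := f (N%:Z - 1 - t).
suff f'0 : forall n : nat, f' n = 0.
  by rewrite -(f'0 (N + n)%N) /f'; congr f; lia.
apply: (@recurrence_forward [seq - j | j <- J] (fun j => m (- j))).
- by rewrite map_inj_uniq //; exact: oppr_inj.
- by case: (J) J0.
- by move=> _ /mapP[j jJ ->]; rewrite opprK mJ.
- by move=> _ _ /mapP[i iJ ->] /mapP[j jJ ->]; rewrite opprK addrC; exact: JN.
- move=> t; rewrite big_map -[RHS](rec (N%:Z - 1 - t)); apply: eq_bigr => j _.
  by rewrite opprK /f'; congr (_ * f _); lia.
move=> k kN; rewrite /f'; have -> : N%:Z - 1 - k%:Z = (N - k.+1)%N by lia.
by apply: fN; lia.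
Qed.

End Annihilators.

(** * Reduction to a line transversal to a primitive direction *)

Lemma pair_mulrz (v : int * int) (n : int) : v *~ n = (v.1 * n, v.2 * n).
Proof.
have mE (k : nat) : v *+ k = (v.1 * k%:Z, v.2 * k%:Z).
  elim: k => [|k IHk]; first by rewrite !mulr0.
  rewrite mulrSr IHk; case: v {IHk} => a b /=.
  by rewrite -[LHS]/(a * k%:Z + a, b * k%:Z + b); congr pair; ring.
case: n => n; rewrite ?NegzE ?mulrNz -?pmulrn mE //=.
by rewrite -[LHS]/(- (v.1 * n.+1%:Z), - (v.2 * n.+1%:Z)) !mulrN.
Qed.

(* Coordinates adapted to a primitive vector [v], where [x * v.1 + y * v.2 = 1]:
   [u = along x y u *: v + across v u *: (-y, x)]. *)
Definition along (x y : int) (u : int * int) : int := u.1 * x + u.2 * y.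
Definition across (v u : int * int) : int := v.1 * u.2 - v.2 * u.1.

Lemma along_acrossK x y v u : x * v.1 + y * v.2 = 1 ->
  v *~ along x y u + (- y, x) *~ across v u = u.
Proof.
case: v u => [v1 v2] [u1 u2] /= xy1; rewrite !pair_mulrz /along /across /=.
rewrite -[LHS]/(v1 * (u1 * x + u2 * y) + (- y) * (v1 * u2 - v2 * u1),
                v2 * (u1 * x + u2 * y) + x * (v1 * u2 - v2 * u1)).
congr pair; [transitivity (u1 * (x * v1 + y * v2)); first by ring
            |transitivity (u2 * (x * v1 + y * v2)); first by ring];
by rewrite xy1 mulr1.
Qed.

Section Line.
Variables (F : closedFieldType) (I : eqType) (s : seq I) (g : I -> F).
Variables (w : I -> int * int) (v : int * int) (x y : int) (z : F).
Hypotheses (xy1 : x * v.1 + y * v.2 = 1) (z0 : z != 0).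

(** Put [Y = X^(-y, x)]. Modulo [X^v - z], the monomial [X^(w i)] is [z] to the power
    [along x y (w i)] times [Y] to the power [across v (w i)]. So this is the coefficient of [Y^j]
    in the reduction of [g]. *)
Definition line_sum (j : int) : F :=
  \sum_(i <- s | across v (w i) == j) g i * z ^ along x y (w i).

Lemma eigen_along (e : int * int -> F) u :
    (forall u, shift_sub (v, 0, z) e u = 0) ->
  e u = z ^ (- along x y u) * e ((- y, x) *~ across v u).
Proof.
move=> e0; have ev p : e (p - v) = z * e p.
  by apply/eqP; rewrite -subr_eq0 -(e0 p) /shift_sub /= subr0.
have evn (n : nat) p : e (p - v *+ n) = z ^+ n * e p.
  elim: n => [|n IHn]; first by rewrite mulr0n subr0 mul1r.
  by rewrite mulrSr opprD addrA ev IHn exprS mulrA.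
have evz (n : int) p : e (p + v *~ n) = z ^ (- n) * e p.
  case: n => n; last by rewrite NegzE mulrNz opprK -pmulrn evn.
  have := evn n (p + v *+ n); rewrite addrK => ->.
  by rewrite -pmulrn mulrA -exprnN mulVf ?mul1r // expf_neq0.
by rewrite -{1}(along_acrossK u xy1) addrC evz.
Qed.

(** On the multiples of [(-y, x)], [e] satisfies the recurrence with coefficients [line_sum], which
    is nontrivial by hypothesis; [eigen_along] recovers [e] from these points. *)
Lemma finitely_determined_line j : line_sum j != 0 ->
  finitely_determined (fun e =>
    annihilated s g w e /\ forall u, shift_sub (v, 0, z) e u = 0).
Proof.
move=> sj; pose U := undup [seq across v (w i) | i <- s].
(* Only lines with nonzero sum are kept, so that the extreme coefficients are invertible; twice the
   largest index bounds the width of the recurrence. *)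
pose J := [seq i <- U | line_sum i != 0].
pose N := (\max_(j <- J) `|j|).*2.
exists [seq (- y, x) *~ n%:Z | n <- iota 0 N] => e [ge e0] eS u.
rewrite (eigen_along _ e0); move: (across v u) => t.
rewrite (_ : e _ = 0) ?mulr0 //.
have jU : j \in U.
  apply: contraNT sj => jU; rewrite /line_sum big1_seq // => i /andP[/eqP jE si].
  by case/negP: jU; rewrite mem_undup -jE; apply/mapP; exists i.
pose f t := e ((- y, x) *~ t).
apply: (@recurrence_unique F J line_sum f N).
- by rewrite filter_uniq ?undup_uniq.
- by apply/eqP => J0; move: (in_nil j); rewrite -J0 mem_filter sj jU.
- by move=> i; rewrite mem_filter => /andP[].
- move=> i k iJ kJ; have Jle l : l \in J -> (`|l| <= \max_(j <- J) `|j|)%N.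
    by move=> lJ; apply: (leq_bigmax_seq (F := fun j : int => `|j|%N)).
  by have := Jle _ iJ; have := Jle _ kJ; rewrite /N; lia.
- move=> t'; rewrite -[RHS](ge ((- y, x) *~ t')).
  have eE i : e ((- y, x) *~ t' - w i) =
      z ^ along x y (w i) * f (t' - across v (w i)).
    rewrite (eigen_along _ e0) /f; congr (z ^ _ * e (_ *~ _)).
      by rewrite pair_mulrz /along /=; ring.
    rewrite pair_mulrz /across /=.
    transitivity (t' * (x * v.1 + y * v.2) - (v.1 * (w i).2 - v.2 * (w i).1)).
      by ring.
    by rewrite xy1 mulr1.
  under [RHS]eq_bigr do rewrite eE mulrA.
  rewrite big_filter big_mkcond /=.
  (* The terms of [g] are grouped by lines: each [i] lies on exactly one line of [U]. *)
  transitivity (\sum_(j <- U) \sum_(i <- s)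
      if across v (w i) == j then g i * z ^ along x y (w i) * f (t' - j) else 0).
    apply: eq_bigr => k _; rewrite -big_mkcond -mulr_suml -/(line_sum k).
    by case: eqP => //= ->; rewrite mul0r.
  rewrite exchange_big /= big_seq [RHS]big_seq; apply: eq_bigr => i si.
  rewrite (bigD1_seq (across v (w i))) ?undup_uniq //=; last first.
    by rewrite mem_undup; apply/mapP; exists i.
  by rewrite eqxx big1 ?addr0 // => k /negPf; rewrite eq_sym => ->.
move=> n nN; apply: eS; apply/mapP; exists n => //.
by rewrite mem_iota.
Qed.

End Line.

(** Write [a - b = d v] with [v] primitive. Up to a monomial, [X^a - X^b] is [X^(d v) - 1], the
    product of the [X^v - z] over the roots [z] of [T^d - 1], all of which are nonzero. *)
Lemma finitely_determined_difference (F : closedFieldType) (I : eqType)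
    (s : seq I) (g : I -> F) (w : I -> int * int) (a b : int * int) :
    a != b ->
    (forall v x y z, x * v.1 + y * v.2 = 1 -> z != 0 ->
       exists j, line_sum s g w v x y z j != 0) ->
  finitely_determined
    (fun e => annihilated s g w e /\ forall u, shift_sub (a, b, 1) e u = 0).
Proof.
move=> ab gP; have [|v [d [d0 /coprimezP[[x y] /= xy1] abE]]] :=
  @primitive_multiple (a - b); first by rewrite subr_eq0.
have [rs] := closed_field_poly_normal ('X^d - 1 : {poly F}).
rewrite lead_coefXnsubC // scale1r => rsE.
have srs : size rs = d.
  by apply: succn_inj; rewrite -(size_prod_XsubC rs id) -rsE size_XnsubC.
have [S SP] : finitely_determined (fun e => annihilated s g w e /\
    forall u, shift_subs [seq (v, 0, z) | z <- rs] e u = 0).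
  apply: finitely_determined_shift_subs => _ /mapP[z zrs ->].
  have z0 : z != 0.
    apply: contraTneq zrs => ->; rewrite -root_prod_XsubC -rsE.
    by rewrite /root !hornerE expr0n gtn_eqF //= sub0r oppr_eq0 oner_eq0.
  by have [j] := gP v x y z xy1 z0; apply: finitely_determined_line.
exists S => e [ge e0]; apply: SP; split=> // u.
rewrite (shift_subs_roots _ (N := d.+1)) ?srs // -rsE.
have ed : e (u - v *+ d) = e u.
  rewrite -abE; apply/eqP; rewrite -subr_eq0 -(e0 (u + b)) /shift_sub /= mul1r.
  by rewrite opprB addrA addrK.
under eq_bigr do rewrite coefB coefXn coef1 mulrBl.
rewrite sumrB big_ord_recr big1 /= => [|i _]; last first.
  by rewrite ltn_eqF ?mul0r.
rewrite eqxx mul1r add0r ed big_ord_recl mul1r big1 => [|i _].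
  by rewrite mulr0n subr0 addr0 subrr.
by rewrite lift0 mul0r.
Qed.

(** * Line factors and finiteness *)

Lemma laurent_mulE (R : realType) (f g : laurent R) w :
  laurent_mul f g w = \sum_(u <- finsupp f) f u * g (w - u).
Proof.
rewrite fsfunE; case: ifPn => // wN; rewrite big_seq big1 // => u uf.
have [gu|] := boolP (w - u \in finsupp g); last first.
  by rewrite mem_finsupp negbK => /eqP->; rewrite mulr0.
case/negP: wN; apply/imfset2P; exists u => //; exists (w - u) => //.
by rewrite addrC subrK.
Qed.

(** Vanishing line sums mean that [g] is zero modulo the binomial [X^v - z], which is the line
    factor [h]; the quotient comes from long division along each line parallel to [v]. *)
Lemma line_sum_factor (R : realType) (g : laurent R) v x y z :
    x * v.1 + y * v.2 = 1 -> z != 0 ->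
    (forall j, line_sum (finsupp g) g id v x y z j = 0) ->
  has_line_factor g.
Proof.
move=> xy1 z0 g0.
have v0 : v != 0.
  by apply/eqP => vE; move: xy1; rewrite vE !mulr0.
pose h : laurent R := [fsfun u in [fset v; 0] => if u == v then 1 else - z].
have hE u : h u = if u == v then 1 else if u == 0 then - z else 0.
  by rewrite fsfunE !inE; case: eqP => //=; case: eqP.
have supph : finsupp h = [fset v; 0].
  apply/fsetP => u; rewrite mem_finsupp hE !inE.
  case: (u == v); first by rewrite oner_eq0.
  by case: (u == 0); rewrite ?oppr_eq0 ?eqxx.
pose A := along x y; pose C := across v.
have Av u : A (u - v) = A u - 1.
  rewrite -[1]xy1 /A /along -[(u - v).1]/(u.1 - v.1) -[(u - v).2]/(u.2 - v.2).
  by ring.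
have Cv u : C (u - v) = C u.
  rewrite /C /across -[(u - v).1]/(u.1 - v.1) -[(u - v).2]/(u.2 - v.2).
  by ring.
(* Solving [q0 (u - v) - z * q0 u = g u] from the far end of each line gives this sum over the
   support points strictly beyond [u]. *)
pose q0 u := \sum_(p <- finsupp g | (C p == C u) && (A u < A p))
   g p * z ^ (A p - A u - 1).
pose M := \max_(p <- finsupp g) maxn `|A p| `|C p|.
have MP p : p \in finsupp g -> (`|A p| <= M)%N /\ (`|C p| <= M)%N.
  move=> pg; apply/andP; rewrite -geq_max.
  exact: (leq_bigmax_seq (F := fun p => maxn `|A p| `|C p|)).
have [rng rngP] : exists rng : seq int, forall i, (`|i| <= M)%N -> i \in rng.
  exists [seq n%:Z - M%:Z | n <- iota 0 M.*2.+1] => i iM.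
  apply/mapP; exists (absz (i + M%:Z)%R); last by lia.
  by rewrite mem_iota; lia.
pose S := [fset p in [seq v *~ i + (- y, x) *~ j | i <- rng, j <- rng]].
have SP u : (`|A u| <= M)%N -> (`|C u| <= M)%N -> u \in S.
  move=> AM CM; rewrite in_fset -(along_acrossK u xy1).
  by apply: (allpairs_f (fun i j => v *~ i + (- y, x) *~ j)); apply: rngP.
have q0S u : u \notin S -> q0 u = 0.
  move=> uS; rewrite /q0 big_seq_cond.
  have [CM|CM] := leqP `|C u| M; last first.
    rewrite big_pred0 // => p; apply/negP => /and3P[pg /eqP Cp _].
    by have [_] := MP _ pg; rewrite Cp leqNgt CM.
  have AM : (M < `|A u|)%N.
    by rewrite ltnNge; apply: contra uS => AM; apply: SP.
  have [Au|Au] := ltrP (A u) 0; last first.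
    rewrite big_pred0 // => p; apply/negP => /and3P[pg _ up].
    by have [] := MP _ pg; move: (A u) (A p) up AM Au; lia.
  (* Here [A u < - M], so the condition [A u < A p] holds throughout the support and the full line
     sum appears. *)
  transitivity (z ^ (- A u - 1) * line_sum (finsupp g) g id v x y z (C u)).
    rewrite /line_sum [in RHS]big_seq_cond mulr_sumr.
    apply: eq_big => [p|p _].
      case pg : (p \in finsupp g) => //=; rewrite -/(C p); case: eqP => //= _.
      by have [] := MP _ pg; move: (A u) (A p) AM Au; lia.
    by rewrite mulrCA -expfzDr //; congr (_ * _ ^ _); rewrite -/(A p); ring.
  by rewrite g0 mulr0.
pose q : laurent R := [fsfun u in S => q0 u].
have qE u : q u = q0 u by rewrite fsfunE; case: ifPn => // /q0S->.
exists h; split.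
  split; first by rewrite supph cardfs2 v0.
  exists v.2, (- v.1), 0; split.
    apply: contraNneq v0 => -[v2 v1]; rewrite [v]surjective_pairing v2.
    by move/eqP: v1; rewrite oppr_eq0 => /eqP->.
  move=> u; rewrite supph !inE => /orP[] /eqP ->; last by rewrite !mulr0.
  by rewrite mulNr mulrC subrr.
exists q; apply/fsfunP => u; rewrite laurent_mulE supph.
rewrite big_fsetU1 ?big_seq_fset1 ?inE //= !hE eqxx eq_sym (negPf v0) eqxx.
rewrite mul1r mulNr subr0 !qE.
(* Translation by [v] turns the strict inequality into a weak one; the only extra term is that of
   [p = u]. *)
have qv : q0 (u - v) =
    \sum_(p <- finsupp g | (C p == C u) && (A u <= A p)) g p * z ^ (A p - A u).
  apply: eq_big => [p|p _]; rewrite Av ?Cv; last by congr (_ * _ ^ _); ring.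
  by congr (_ && _); move: (A u) (A p); lia.
rewrite qv (bigID (fun p => A u < A p)) /= addrC.
have -> : \sum_(p <- finsupp g | (C p == C u) && (A u <= A p) && (A u < A p))
    g p * z ^ (A p - A u) = z * q0 u.
  rewrite mulr_sumr; apply: eq_big => [p|p _].
    by rewrite -andbA; congr (_ && _); move: (A u) (A p); lia.
  rewrite mulrCA -{2}[z]expr1z -expfzDr //; congr (_ * _ ^ _); ring.
rewrite addKr.
have uP p : (C p == C u) && (A u <= A p) && ~~ (A u < A p) = (p == u).
  apply/idP/eqP => [|->]; last by rewrite eqxx lexx ltxx.
  move=> /andP[/andP[/eqP Cp up] pu].
  rewrite -(along_acrossK p xy1) -(along_acrossK u xy1) -/C -/A Cp.
  by congr (v *~ _ + _); move: (A u) (A p) up pu; lia.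
under eq_bigl do rewrite uP.
have [ug|] := boolP (u \in finsupp g).
  rewrite big_mkcond (bigD1_seq u) //= ?fset_uniq // eqxx subrr mulr1.
  by rewrite big1 ?addr0 // => p /negPf->.
move=> ug; rewrite big_seq_cond big_pred0; last first.
  by move=> p; apply/negP => /andP[pg /eqP pu]; move: ug; rewrite -pu pg.
by move: ug; rewrite mem_finsupp negbK => /eqP.
Qed.

(** * Differences of coverings *)

Lemma is_coveringP (D : {fset int * int}) (s : seq (int * int)) b a c :
    perm_eq s D ->
  is_covering D b a c <->
  forall u, count (fun d => c (u + d)) s = if c u then b else a.
Proof.
move=> sD; suff cardE u :
    #|` [fset v in [fset u + d | d in D] | c v]| = count (fun d => c (u + d)) s.
  by split=> cov u; rewrite -[RHS](cov u) cardE.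
rewrite (permP sD) -(count_map (fun d => u + d) c) -size_filter.
apply: perm_size; apply: uniq_perm; first exact: fset_uniq.
  by rewrite filter_uniq // map_inj_uniq ?fset_uniq //; exact: addrI.
move=> v; rewrite mem_filter !inE /= andbC; congr (_ && _).
by apply/imfsetP/mapP => -[d dD ->]; exists d.
Qed.

Lemma sum_count (T : Type) (P : pred T) (s : seq T) :
  \sum_(x <- s) (P x)%:Z = (count P s)%:Z.
Proof. by elim: s => [|x s IHs]; rewrite ?big_nil // big_cons IHs. Qed.

(** The coefficients of [g] are kept as integers because the dilation argument reduces modulo
    primes. *)
Definition gcoef (D : {fset int * int}) (b a : nat) (v : int * int) : int :=
  (- v \in D)%:Z - (if v == 0 then b%:Z - a%:Z else 0).

Lemma gpolyE (R : realType) D b a v : gpoly R D b a v = (gcoef D b a v)%:~R.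
Proof.
have fE : fpoly R D v = ((- v \in D)%:Z)%:~R.
  have -> : (- v \in D) = (v \in [fset - u | u in D]).
    apply/idP/imfsetP => [vD|[d dD ->]]; last by rewrite opprK.
    by exists (- v); rewrite ?opprK.
  by rewrite fsfunE; case: ifP.
have cE : laurent_const (b%:R - a%:R : R[i]) v =
    (if v == 0 then b%:Z - a%:Z else 0)%:~R.
  by rewrite fsfunE !inE; case: eqP => // _; rewrite rmorphB.
rewrite /gpoly fsfunE; case: ifPn => [_|]; rewrite /gcoef rmorphB /= ?fE ?cE //.
by rewrite inE !mem_finsupp negb_or !negbK fE cE => /andP[/eqP-> /eqP->]; rewrite subrr.
Qed.

(** For a covering, the sum of [c] over [u + D] is [a + (b - a) c u], and the constant [a] cancels
    in a difference. The exponents of [f_D] are the negated points of [D], whence the values at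
    [u + d]. *)
Lemma covering_difference (R : realType) D b a c c' u :
    is_covering D b a c -> is_covering D b a c' ->
  \sum_(v <- finsupp (gpoly R D b a))
    gcoef D b a v * ((c (u - v))%:Z - (c' (u - v))%:Z) = 0.
Proof.
move=> /(is_coveringP _ _ _ (perm_refl _)) cov.
move=> /(is_coveringP _ _ _ (perm_refl _)) cov'.
pose e v : int := (c v)%:Z - (c' v)%:Z; rewrite -/(e (u - _)).
pose W := [fset - d | d in D] `|` [fset (0 : int * int)].
have gW v : v \notin W -> gcoef D b a v = 0.
  rewrite !inE negb_or /gcoef => /andP[vD /negPf->]; case: (boolP (- v \in D)) => // vD'.
  by case/negP: vD; apply/imfsetP; exists (- v); rewrite ?opprK.
(* The support of [g] is enlarged to [W], where the contributions of [D] and of the constant can be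
   summed separately even if [0] lies in [D]. *)
have -> : \sum_(v <- finsupp (gpoly R D b a)) gcoef D b a v * e (u - v) =
    \sum_(v <- W) gcoef D b a v * e (u - v).
  apply: big_fset_incl => [|v _].
    apply/fsubsetP => v; rewrite mem_finsupp gpolyE; apply: contraNT => /gW->.
    by [].
  rewrite mem_finsupp negbK gpolyE intr_eq0 => /eqP->.
  by rewrite mul0r.
under eq_bigr do rewrite /gcoef mulrBl.
rewrite sumrB.
have -> : \sum_(v <- W) (- v \in D)%:Z * e (u - v) = \sum_(d <- D) e (u + d).
  transitivity (\sum_(v <- W | - v \in D) e (u - v)).
    rewrite [RHS]big_mkcond; apply: eq_bigr => v _.
    by case: (- v \in D); rewrite ?mul1r ?mul0r.
  rewrite -big_filter (perm_big [seq - d | d <- D]) /=.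
    by rewrite big_map; apply: eq_bigr => d _; rewrite opprK.
  apply: uniq_perm; first by rewrite filter_uniq ?fset_uniq.
    by rewrite map_inj_uniq ?fset_uniq //; exact: oppr_inj.
  move=> v; rewrite mem_filter; apply/andP/mapP => [[vD _]|[d dD ->]].
    by exists (- v); rewrite ?opprK.
  rewrite opprK dD !inE; split=> //; apply/orP; left.
  by apply/imfsetP; exists d.
have -> : \sum_(v <- W) (if v == 0 then b%:Z - a%:Z else 0) * e (u - v) =
    (b%:Z - a%:Z) * e u.
  rewrite (bigD1_seq 0) ?fset_uniq //= ?inE ?eqxx ?orbT // subr0.
  by rewrite big1 ?addr0 // => v /negPf->; rewrite mul0r.
rewrite /e sumrB !sum_count cov cov'.
by case: (c u); case: (c' u) => /=; ring.
Qed.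

(** The product of differences built from the support of [g] depends on [D], [b] and [a] alone, so
    one set [S] serves all pairs of coverings. *)
Lemma coverings_determined (R : realType) (D : {fset int * int}) (b a : nat) :
    ~ has_line_factor (gpoly R D b a) ->
  exists S : seq (int * int), forall c c',
    is_covering D b a c -> is_covering D b a c' ->
    (forall u, u \in S -> c u = c' u) -> c = c'.
Proof.
set g := gpoly R D b a => nlf.
have lineP v x y z : x * v.1 + y * v.2 = 1 -> z != 0 ->
    exists j, line_sum (finsupp g) g id v x y z j != 0.
  move=> xy1 z0; apply: contrapT => /forallNP g0; apply: nlf.
  apply: (line_sum_factor xy1 z0) => j; apply/eqP.
  by have /negP := g0 j; rewrite negbK.
(* [g] is nonzero, since already for [v = (1, 0)] and [z = 1] some line sum is nonzero. *)
have [v0 [V VE]] : exists v0 V, perm_eq (finsupp g) (v0 :: V).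
  have [j] := lineP (1, 0) 1 0 1 (erefl _) (oner_neq0 _).
  rewrite /line_sum; case: (enum_fset (finsupp g)) => [|v0 V _]; last by exists v0, V.
  by rewrite big_nil eqxx.
have uV : uniq (v0 :: V) by rewrite -(perm_uniq VE) fset_uniq.
pose B := (absz (\sum_(v <- finsupp g) `|gcoef D b a v|)).+1.
have BP : \sum_(v <- finsupp g) `|gcoef D b a v| < B%:Z.
  have : 0 <= \sum_(v <- finsupp g) `|gcoef D b a v| by apply: sumr_ge0.
  by rewrite /B; lia.
have r0 : (0 < B`!)%N by exact: fact_gt0.
have dil := coprime_dilation (B := B).
move: (B`!) r0 dil => r r0 dil.
have [S SP] : finitely_determined (fun e => annihilated (finsupp g) g id e /\
    forall u, shift_subs [seq (v0 *+ r, w *+ r, 1) | w <- V] e u = 0).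
  apply: finitely_determined_shift_subs => _ /mapP[w wV ->].
  apply: finitely_determined_difference => //.
  apply: contraTneq uV => /eqP; rewrite /= negb_and negbK; apply: contraTT.
  rewrite negb_or => /andP[v0V _]; have : v0 != w by apply: contraNneq v0V => ->.
  have rz : r%:Z != 0 by rewrite eqz_nat -lt0n.
  rewrite !pmulrn !pair_mulrz; apply: contraNneq => -[/(mulIf rz) + /(mulIf rz)].
  by case: (v0) (w) => ? ? [? ?] /= -> ->.
exists S => c c' cov cov' ccS.
pose e v : int := (c v)%:Z - (c' v)%:Z.
pose E w u : R[i] := g w * (e u)%:~R.
have e1 u : `|e u| <= 1 by rewrite /e; case: (c u); case: (c' u).
have e0 u : \sum_(v <- finsupp g) gcoef D b a v * e (u - v) = 0.
  exact: covering_difference cov cov'.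
have EE k u : \sum_(w <- v0 :: V) E w (u - w *+ (1 + k * r)) = 0.
  rewrite -(perm_big _ VE) -[RHS](rmorph0 intr).
  rewrite -(dil _ (finsupp g) (gcoef D b a) id e k e0 e1 BP u) rmorph_sum.
  by apply: eq_bigr => w _; rewrite /E rmorphM /= -(gpolyE R).
(* [eliminate] isolates the term of [v0], and [E v0 = g v0 * e] inherits annihilation by [g] from
   [e]. *)
have Ev0 u : E v0 u = 0.
  apply: (SP (E v0)) => [|{}u uS]; last first.
    by rewrite /E /e (ccS _ uS) subrr mulr0.
  split=> [{}u|{}u]; last exact: (eliminate EE).
  rewrite /E; under eq_bigr do rewrite mulrCA.
  rewrite -mulr_sumr [X in _ * X](_ : _ = 0) ?mulr0 //.
  rewrite -[RHS](rmorph0 intr) -(e0 u) rmorph_sum.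
  by apply: eq_bigr => w _; rewrite rmorphM /= -(gpolyE R).
have gv0 : g v0 != 0 by rewrite -mem_finsupp (perm_mem VE) mem_head.
apply/funext => u; have /eqP := Ev0 u.
rewrite mulf_eq0 (negPf gv0) intr_eq0 /e; case: (c u); case: (c' u) => //=.
Qed.

Lemma finite_coverings (R : realType) (D : {fset int * int}) (b a : nat) :
  ~ has_line_factor (gpoly R D b a) -> finite_set (coverings D b a).
Proof.
move=> /coverings_determined[S SP].
(* [h] rebuilds a covering from its bits on [S]. A tuple that arises from no covering is sent to the
   constant [false], as only an inclusion into the image of [h] is needed. *)
pose h (t : (size S).-tuple bool) : configuration :=
  xget (fun=> false) [set c | is_covering D b a c /\ [seq c u | u <- S] = t]%classic.
apply: (@sub_finite_set _ _ (h @` setT)%classic); last first.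
  exact/finite_image/finite_finset.
move=> c cov; exists (map_tuple c (in_tuple S)) => //.
have [] := @xgetPex _ (fun=> false) [set c' | is_covering D b a c' /\
  [seq c' u | u <- S] = map_tuple c (in_tuple S)]%classic; first by exists c.
move=> cov' cS; apply: SP => // u uS.
by have /eq_in_map/(_ u uS) := cS.
Qed.

(** * Computability of list-processing functions *)

Local Close Scope ring_scope.
Local Close Scope fset_scope.

(** The instances below are chosen so that, by conversion, the code of an [instance] is its
    [enc_input] and the code of a list of blocks is its [enc_output]. *)
Class encoding (T : Type) := encode : T -> tree.

#[local] Instance encoding_unit : encoding unit := fun=> Leaf.
#[local] Instance encoding_bool : encoding bool := enc_bool.
#[local] Instance encoding_nat : encoding nat := enc_nat.
#[local] Instance encoding_int : encoding int := enc_int.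
#[local] Instance encoding_seq T (eT : encoding T) : encoding (seq T) := enc_seq encode.
#[local] Instance encoding_pair A B (eA : encoding A) (eB : encoding B) :
  encoding (A * B) := fun x => Node (encode x.1) (encode x.2).

Definition computes {A B : Type} {eA : encoding A} {eB : encoding B}
    (f : A -> B) : Prop :=
  exists p, forall x, eval p (encode x) (encode (f x)).

Section Combinators.
Context {A B C T : Type}.
Context {eA : encoding A} {eB : encoding B} {eC : encoding C} {eT : encoding T}.

Lemma computes_id : computes (fun x : A => x).
Proof. by exists PId => x; constructor. Qed.

Lemma computes_comp (g : B -> C) (f : A -> B) :
  computes g -> computes f -> computes (fun x => g (f x)).
Proof. by move=> [p gP] [q fP]; exists (PSeq q p) => x; econstructor. Qed.

Lemma computes_cst (b : B) : computes (fun _ : A => b).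
Proof.
suff /(_ (encode b))[p pP] : forall t, exists p, forall x : tree, eval p x t.
  by exists p => x; apply: pP.
elim => [|l [p IHl] r [q IHr]]; first by exists PLeaf => x; constructor.
by exists (PNode p q) => x; constructor.
Qed.

Lemma computes_pair (f : A -> B) (g : A -> C) :
  computes f -> computes g -> computes (fun x => (f x, g x)).
Proof. by move=> [p fP] [q gP]; exists (PNode p q) => x; constructor. Qed.

Lemma computes_fst (f : A -> B * C) : computes f -> computes (fun x => (f x).1).
Proof.
move=> [p fP]; exists (PSeq p PHd) => x; econstructor; first exact: fP.
exact: (EHd (encode (f x))).
Qed.

Lemma computes_snd (f : A -> B * C) : computes f -> computes (fun x => (f x).2).
Proof.
move=> [p fP]; exists (PSeq p PTl) => x; econstructor; first exact: fP.
exact: (ETl (encode (f x))).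
Qed.

Lemma computes_if (c : A -> bool) (f g : A -> B) :
    computes c -> computes f -> computes g ->
  computes (fun x => if c x then f x else g x).
Proof.
move=> [p cP] [q fP] [r gP]; exists (PIf p q r) => x.
by case: (c x) (cP x) => /= cx; [apply: EIfTrue cx _ | apply: EIfFalse cx _].
Qed.

Lemma computes_cons (f : A -> T) (g : A -> seq T) :
  computes f -> computes g -> computes (fun x => f x :: g x).
Proof. by move=> [p fP] [q gP]; exists (PNode p q) => x; apply: ENode. Qed.

(* [l] is any list-like encoded data: lists, but also unary numbers. *)
Lemma computes_foldl_spine (step : A -> B -> T -> B) (init : A -> B)
    (l : A -> seq T) (pl : prog) :
    computes (fun z : A * (B * T) => step z.1 z.2.1 z.2.2) -> computes init ->
    (forall x, eval pl (encode x) (enc_seq encode (l x))) ->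
  computes (fun x => foldl (step x) (init x) (l x)).
Proof.
move=> [p stepP] [q initP] lP.
pose body := PNode PHd (PNode
  (PSeq (PNode PHd (PNode (PSeq PTl PHd) (PSeq PTl (PSeq PTl PHd)))) p)
  (PSeq PTl (PSeq PTl PTl))).
exists (PSeq (PNode PId (PNode q pl))
  (PSeq (PWhile (PSeq PTl PTl) body) (PSeq PTl PHd))) => x.
apply: ESeq.
  by apply: ENode; [exact: EId|apply: ENode; [exact: initP|exact: lP]].
have loop : forall s acc, eval (PWhile (PSeq PTl PTl) body)
    (Node (encode x) (Node (encode acc) (enc_seq encode s)))
    (Node (encode x) (Node (encode (foldl (step x) acc s)) Leaf)); last first.
  apply: ESeq; first exact: loop.
  apply: ESeq; first exact: ETl.
  by exact: (EHd (Node _ _)).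
elim=> [|t s IHs] acc /=.
  by apply: EWhileStop; apply: ESeq; [exact: ETl|exact: (ETl (Node _ _))].
apply: (EWhileStep (l := encode t) (r := enc_seq encode s)); last exact: IHs.
  by apply: ESeq; [exact: ETl|exact: (ETl (Node _ (Node _ _)))].
apply: ENode; first exact: (EHd (Node _ _)).
have tl2 : eval (PSeq PTl PTl)
    (Node (encode x) (Node (encode acc) (Node (encode t) (enc_seq encode s))))
    (Node (encode t) (enc_seq encode s)).
  by apply: ESeq; [exact: ETl|exact: (ETl (Node _ _))].
apply: ENode; last first.
  apply: ESeq; first exact: ETl.
  by apply: ESeq; [exact: ETl|exact: (ETl (Node _ _))].
apply: ESeq; last exact: (stepP (x, (acc, t))).
apply: ENode; first exact: (EHd (Node _ _)).
apply: ENode; first by apply: ESeq; [exact: ETl|exact: (EHd (Node _ _))].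
apply: ESeq; first exact: ETl.
by apply: ESeq; [exact: ETl|exact: (EHd (Node _ _))].
Qed.

Lemma computes_foldl (step : A -> B -> T -> B) (init : A -> B) (l : A -> seq T) :
    computes (fun z : A * (B * T) => step z.1 z.2.1 z.2.2) ->
    computes init -> computes l ->
  computes (fun x => foldl (step x) (init x) (l x)).
Proof. by move=> stepP initP [pl lP]; apply: computes_foldl_spine lP. Qed.

(** Unlike the total functions above, a loop may fail to halt, so its result is stated relative to
    the first [k] at which the test fails. *)
Lemma computes_while (c : A -> bool) (f : A -> A) : computes c -> computes f ->
  exists p, forall x k, (forall i, (i < k)%N -> c (iter i f x)) ->
    ~~ c (iter k f x) -> eval p (encode x) (encode (iter k f x)).
Proof.
move=> [p cP] [q fP]; exists (PWhile p q) => x k.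
elim: k x => [|k IHk] x ck /= ckN.
  by apply: EWhileStop; have := cP x; rewrite (negPf ckN).
apply: (EWhileStep (l := Leaf) (r := Leaf) (y := encode (f x))).
- by have := cP x; rewrite (ck 0%N (ltn0Sn _)).
- exact: fP.
rewrite -iterS iterSr; apply: IHk => [i ik|]; last by rewrite -iterSr.
by rewrite -iterSr; apply: ck.
Qed.

End Combinators.

(** The code of a number [n] is also that of a list of [n] units, so iteration is a fold over that
    list. *)
Lemma computes_iter {A B : Type} {eA : encoding A} {eB : encoding B}
    (step : A -> B -> B) (init : A -> B) (n : A -> nat) :
    computes (fun z : A * B => step z.1 z.2) -> computes init -> computes n ->
  computes (fun x => iter (n x) (step x) (init x)).
Proof.
move=> stepP initP [p nP].
have [|||q qP] := computes_foldl_spine (step := fun x b (_ : unit) => step x b)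
  (init := init) (l := fun x => nseq (n x) tt) (pl := p).
- have [r rP] := stepP; exists (PSeq (PNode PHd (PSeq PTl PHd)) r) => -[x [y []]].
  apply: ESeq; last exact: (rP (x, y)).
  apply: ENode; first exact: (EHd (Node _ _)).
  by apply: ESeq; [exact: ETl|exact: (EHd (Node _ _))].
- exact: initP.
- move=> x; have := nP x; congr eval; rewrite /encode /encoding_nat.
  by elim: (n x) => //= k ->.
exists q => x; have := qP x; congr (eval _ _ (encode _)).
by elim: (n x) (init x) => // k IHk b; rewrite iterSr -IHk.
Qed.

Section Lists.
Context {A B T U : Type}.
Context {eA : encoding A} {eB : encoding B} {eT : encoding T} {eU : encoding U}.

Lemma computes_rev (l : A -> seq T) : computes l -> computes (fun x => rev (l x)).
Proof.
move=> lP; have [|||p pP] := computes_foldl (step := fun (_ : A) s (t : T) => t :: s)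
  (init := fun=> [::]) (l := l) => //.
- apply: computes_cons; last by apply: computes_fst; apply: computes_snd; exact: computes_id.
  by apply: computes_snd; apply: computes_snd; exact: computes_id.
- exact: computes_cst.
exists p => x; rewrite (_ : rev (l x) = foldl (fun s t => t :: s) [::] (l x)) //.
by rewrite /rev; elim: (l x) [::] => //= t s IHs acc; exact: IHs.
Qed.

Lemma computes_foldr (step : A -> T -> B -> B) (init : A -> B) (l : A -> seq T) :
    computes (fun z : A * (B * T) => step z.1 z.2.2 z.2.1) ->
    computes init -> computes l ->
  computes (fun x => foldr (step x) (init x) (l x)).
Proof.
move=> stepP initP lP; have [|||p pP] :=
  computes_foldl (step := fun x b t => step x t b) (init := init)
    (l := fun x => rev (l x)) => //; first exact: computes_rev.
by exists p => x; have := pP x; rewrite foldl_rev.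
Qed.

End Lists.

Section Library.
Context {A T U : Type} {eA : encoding A} {eT : encoding T} {eU : encoding U}.

Lemma computes_negb (f : A -> bool) :
  computes f -> computes (fun x => ~~ f x).
Proof. by move=> fP; apply: computes_if fP _ _; apply: computes_cst. Qed.

Lemma computes_andb (f g : A -> bool) :
  computes f -> computes g -> computes (fun x => f x && g x).
Proof. by move=> fP gP; apply: computes_if fP gP _; apply: computes_cst. Qed.

Lemma computes_implb (f g : A -> bool) :
  computes f -> computes g -> computes (fun x => f x ==> g x).
Proof. by move=> fP gP; apply: computes_if fP gP _; apply: computes_cst. Qed.

Lemma computes_eqb (f g : A -> bool) :
  computes f -> computes g -> computes (fun x => f x == g x).
Proof.
move=> fP gP; have [p pP] := computes_if fP gP (computes_negb gP).
by exists p => x; have := pP x; case: (f x) (g x) => [] [].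
Qed.

Lemma computes_succn (f : A -> nat) :
  computes f -> computes (fun x => (f x).+1).
Proof. by move=> [p fP]; exists (PNode PLeaf p) => x; apply: ENode; first exact: ELeaf. Qed.

Lemma computes_predn (f : A -> nat) :
  computes f -> computes (fun x => (f x).-1).
Proof.
move=> [p fP]; exists (PSeq p PTl) => x; apply: ESeq; first exact: fP.
by have := ETl (encode (f x)); rewrite /encode /encoding_nat; case: (f x).
Qed.

Lemma computes_eqn0 (f : A -> nat) :
  computes f -> computes (fun x => f x == 0%N).
Proof.
move=> [p fP]; exists (PIf p PLeaf (PNode PLeaf PLeaf)) => x; have := fP x.
rewrite /encode /encoding_nat; case: (f x) => /= [|n] fx.
  by apply: EIfFalse fx _; apply: ENode; exact: ELeaf.
by apply: EIfTrue fx _; exact: ELeaf.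
Qed.

Lemma computes_behead (f : A -> seq T) :
  computes f -> computes (fun x => behead (f x)).
Proof.
move=> [p fP]; exists (PSeq p PTl) => x; apply: ESeq; first exact: fP.
by have := ETl (encode (f x)); rewrite /encode /encoding_seq; case: (f x).
Qed.

(** The head of [Leaf] is [Leaf], so the default must have this code to be returned on the empty
    list. *)
Lemma computes_head (t0 : T) (f : A -> seq T) : encode t0 = Leaf ->
  computes f -> computes (fun x => head t0 (f x)).
Proof.
move=> t0L [p fP]; exists (PSeq p PHd) => x; apply: ESeq; first exact: fP.
by have := EHd (encode (f x)); case: (f x) => [|t s] //=; rewrite t0L.
Qed.

Lemma computes_absz (f : A -> int) :
  computes f -> computes (fun x => `|f x|%N).
Proof.
move=> [p fP]; exists (PSeq p PTl) => x; apply: ESeq; first exact: fP.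
exact: (ETl (encode (f x))).
Qed.

Lemma computes_ltz0 (f : A -> int) :
  computes f -> computes (fun x => (f x < 0)%R).
Proof.
move=> [p fP]; exists (PSeq p PHd) => x; apply: ESeq; first exact: fP.
exact: (EHd (encode (f x))).
Qed.

End Library.

(** Computability proofs follow the syntax of the function: its outermost operation selects the
    rule. The argument [rules] lets later layers add operations. *)
Ltac computes_core rules :=
  repeat (cbv beta; lazymatch goal with
  | |- computes (fun _ => ?b) => exact: computes_cst
  | |- computes (fun x => x) => exact: computes_id
  | |- computes fst => exact: (computes_fst computes_id)
  | |- computes snd => exact: (computes_snd computes_id)
  | |- computes (fun _ => fst _) => apply computes_fst
  | |- computes (fun _ => snd _) => apply computes_snd
  | |- computes (fun _ => (_, _)) => apply computes_pair
  | |- computes (fun _ => _ :: _) => apply computes_cons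
  | |- computes (fun _ => _ && _) => apply computes_andb
  | |- computes (fun _ => _ ==> _) => apply computes_implb
  | |- computes (fun _ => ~~ _) => apply computes_negb
  | |- computes (fun _ => if _ then _ else _) => apply computes_if
  | |- computes (fun _ => foldr _ _ _) => apply computes_foldr
  | |- computes (fun _ => S _) => apply computes_succn
  | |- computes (fun _ => predn _) => apply computes_predn
  | |- computes (fun _ => _ == 0%N) => apply computes_eqn0
  | |- computes (fun _ => _ == _) => first [apply computes_eqb | rules]
  | |- computes (fun _ => behead _) => apply computes_behead
  | |- computes (fun _ => iter _ _ _) => apply computes_iter
  | |- computes (fun _ => absz _) => apply computes_absz
  | |- computes (fun _ => (_ < 0)%R) => apply computes_ltz0
  | H : computes ?h |- computes (fun x => ?h (@?g x)) =>
      refine (computes_comp (f := g) H _)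
  | |- computes _ => rules
  end); try assumption.

Lemma eq_computes {A B : Type} {eA : encoding A} {eB : encoding B} (f g : A -> B) :
  g =1 f -> computes f -> computes g.
Proof. by move=> gf [p fP]; exists p => x; rewrite gf. Qed.

(** * Arithmetic and list operations on codes *)

Section Arithmetic.
Context {A : Type} {eA : encoding A}.
Variables f g : A -> nat.
Hypotheses (fP : computes f) (gP : computes g).

Lemma computes_addn : computes (fun x => (f x + g x)%N).
Proof.
apply: (@eq_computes _ _ _ _ (fun x => iter (f x) succn (g x))).
  by move=> x; rewrite iter_succn addnC.
by computes_core fail.
Qed.

Lemma computes_subn : computes (fun x => (f x - g x)%N).
Proof.
apply: (@eq_computes _ _ _ _ (fun x => iter (g x) predn (f x))).
  by move=> x; elim: (g x) => [|n IHn]; rewrite ?subn0 // subnS IHn.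
by computes_core fail.
Qed.

End Arithmetic.

Ltac computes_arith rules := computes_core ltac:(idtac; lazymatch goal with
  | |- computes (fun _ => addn _ _) => apply computes_addn
  | |- computes (fun _ => subn _ _) => apply computes_subn
  | |- _ => rules
  end).

Section Lists.
Context {A T U : Type} {eA : encoding A} {eT : encoding T} {eU : encoding U}.

Lemma computes_leqn (f g : A -> nat) : computes f -> computes g ->
  computes (fun x => (f x <= g x)%N).
Proof. by move=> fP gP; rewrite /leq; computes_arith fail. Qed.

Lemma computes_eqn (f g : A -> nat) : computes f -> computes g ->
  computes (fun x => f x == g x).
Proof.
move=> fP gP.
apply: (@eq_computes _ _ _ _ (fun x => (f x <= g x) && (g x <= f x))).
  by move=> x; rewrite eqn_leq.
by apply: computes_andb; apply: computes_leqn.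
Qed.

Lemma computes_nth (t0 : T) (l : A -> seq T) (n : A -> nat) :
    encode t0 = Leaf -> computes l -> computes n ->
  computes (fun x => nth t0 (l x) (n x)).
Proof.
move=> t0L lP nP.
apply: (@eq_computes _ _ _ _ (fun x => head t0 (iter (n x) behead (l x)))).
  move=> x; elim: (n x) (l x) => [|m IHm] s; first by rewrite nth0.
  by rewrite -nth_behead IHm iterSr.
by apply: computes_head => //; computes_core fail.
Qed.

Lemma computes_map (f : A -> T -> U) (l : A -> seq T) :
    computes (fun z : A * T => f z.1 z.2) -> computes l ->
  computes (fun x => [seq f x t | t <- l x]).
Proof.
move=> fP lP.
apply: (@eq_computes _ _ _ _ (fun x => foldr (fun t s => f x t :: s) [::] (l x))).
  by [].
computes_core fail.
by apply: (computes_comp (f := fun z : A * (seq U * T) => (z.1, z.2.2)) fP); computes_core fail.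
Qed.

Lemma computes_filter (f : A -> T -> bool) (l : A -> seq T) :
    computes (fun z : A * T => f z.1 z.2) -> computes l ->
  computes (fun x => [seq t <- l x | f x t]).
Proof.
move=> fP lP.
apply: (@eq_computes _ _ _ _
  (fun x => foldr (fun t s => if f x t then t :: s else s) [::] (l x))).
  by [].
computes_core fail.
by apply: (computes_comp (f := fun z : A * (seq T * T) => (z.1, z.2.2)) fP); computes_core fail.
Qed.

Lemma computes_all (f : A -> T -> bool) (l : A -> seq T) :
    computes (fun z : A * T => f z.1 z.2) -> computes l ->
  computes (fun x => all (f x) (l x)).
Proof.
move=> fP lP.
apply: (@eq_computes _ _ _ _ (fun x => foldr (fun t s => f x t && s) true (l x))).
  by [].
computes_core fail.
by apply: (computes_comp (f := fun z : A * (bool * T) => (z.1, z.2.2)) fP); computes_core fail.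
Qed.

Lemma computes_count (f : A -> T -> bool) (l : A -> seq T) :
    computes (fun z : A * T => f z.1 z.2) -> computes l ->
  computes (fun x => count (f x) (l x)).
Proof.
move=> fP lP.
apply: (@eq_computes _ _ _ _
  (fun x => foldr (fun t s => if f x t then s.+1 else s) 0 (l x))).
  by move=> x; elim: (l x) => //= t s ->; case: (f x t).
computes_core fail.
by apply: (computes_comp (f := fun z : A * (nat * T) => (z.1, z.2.2)) fP); computes_core fail.
Qed.

Lemma computes_cat (l1 l2 : A -> seq T) : computes l1 -> computes l2 ->
  computes (fun x => l1 x ++ l2 x).
Proof.
move=> l1P l2P.
apply: (@eq_computes _ _ _ _ (fun x => foldr (fun t s => t :: s) (l2 x) (l1 x))).
  by move=> x; elim: (l1 x) => //= t s ->.
by computes_core fail.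
Qed.

End Lists.

Ltac computes_lists rules := computes_arith ltac:(idtac; lazymatch goal with
  | |- computes (fun _ => _ == _) => apply computes_eqn
  | |- computes (fun _ => leq _ _) => apply computes_leqn
  | |- computes (fun _ => nth _ _ _) => apply computes_nth; [by [] | | ]
  | |- computes (fun _ => map _ _) => apply computes_map
  | |- computes (fun _ => seq.filter _ _) => apply computes_filter
  | |- computes (fun _ => all _ _) => apply computes_all
  | |- computes (fun _ => count _ _) => apply computes_count
  | |- computes (fun _ => _ ++ _) => apply computes_cat
  | |- _ => rules
  end).

Lemma computes_iota0 {A : Type} {eA : encoding A} (n : A -> nat) :
  computes n -> computes (fun x => iota 0 (n x)).
Proof.
move=> nP; apply: (@eq_computes _ _ _ _
    (fun x => iter (n x) (fun s => 0%N :: [seq k.+1 | k <- s]) [::])).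
  by move=> x; elim: (n x) => //= m <-; rewrite -[1%N]addn0 iotaDl.
by computes_lists fail.
Qed.

Lemma computes_flatten {A T : Type} {eA : encoding A} {eT : encoding T}
    (l : A -> seq (seq T)) :
  computes l -> computes (fun x => flatten (l x)).
Proof.
by move=> lP; rewrite /flatten; computes_lists fail.
Qed.

(** * The search program *)

Definition bit (M : seq (seq bool)) (i j : nat) : bool := nth false (nth [::] M i) j.

(** This is [n + d] when [|d| <= n], kept within the natural numbers that serve as matrix
    indices. *)
Definition shift_coord (n : nat) (d : int) : nat :=
  if (d < 0)%R then n - `|d| else n + `|d|.

Definition words (T : Type) (L : seq T) (m : nat) : seq (seq T) :=
  iter m (fun W => flatten [seq [seq t :: w | w <- W] | t <- L]) [:: [::]].

Definition matrices (m : nat) : seq (seq (seq bool)) :=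
  words (words [:: true; false] m) m.

Definition instance := (seq (int * int) * (nat * nat))%type.

(** Window indices from [0] to [4n] stand for the coordinates from [-2n] to [2n]; matrix indices are
    larger by [n], since they start from the coordinate [-3n]. *)
Definition window (n : nat) : seq nat := iota 0 (n + n + n + n).+1.
Definition side (n : nat) : nat := (n + n + (n + n + (n + n))).+1.

(* A matrix of size [6n+1] represents a pattern on [[-3n, 3n]^2]; the covering
   condition is tested at the points of [[-2n, 2n]^2], the neighbours of which
   lie in the pattern when [D] is contained in [[-n, n]^2]. *)
Definition admissible (x : instance) (n : nat) (M : seq (seq bool)) : bool :=
  all (fun i => all (fun j =>
    count (fun d => bit M (i + shift_coord n d.1) (j + shift_coord n d.2)) x.1 ==
    if bit M (i + n) (j + n) then x.2.1 else x.2.2) (window n)) (window n).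

(** Matrix index [3n] is the origin. If the bits at distance [n] from it along both axes are forced
    to agree with its own, then [n] is a period of every covering in both directions, because
    translates of coverings are coverings. *)
Definition certificate (x : instance) (n : nat) : bool :=
  [&& ~~ (n == 0%N),
      all (fun d => (`|d.1| <= n) && (`|d.2| <= n)) x.1 &
      all (fun M => admissible x n M ==>
        ((bit M (n + n + n) (n + n + n) == bit M (n + n + n + n) (n + n + n)) &&
         (bit M (n + n + n) (n + n + n) == bit M (n + n + n) (n + n + n + n))))
      (matrices (side n))].

Definition periodic_matrix (n : nat) (M : seq (seq bool)) : bool :=
  all (fun i => all (fun j => (bit M i j == bit M (i + n) j) &&
                              (bit M j i == bit M j (i + n)))
    (iota 0 (side n))) (iota 0 (side n - n)).

(** The coordinates from [0] to [n - 1] form a fundamental domain for the translations by [n]. *)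
Definition central_block (n : nat) (M : seq (seq bool)) : seq (seq bool) :=
  [seq [seq bit M (i + (n + n + n)) (j + (n + n + n)) | j <- iota 0 n] | i <- iota 0 n].

Definition blocks (x : instance) (n : nat) : seq (seq (seq bool)) :=
  [seq central_block n M |
    M <- [seq M <- matrices (side n) | admissible x n M && periodic_matrix n M]].

Section ProgramComputability.
Context {A : Type} {eA : encoding A}.

Lemma computes_bit (M : A -> seq (seq bool)) (i j : A -> nat) :
  computes M -> computes i -> computes j -> computes (fun x => bit (M x) (i x) (j x)).
Proof. by move=> MP iP jP; rewrite /bit; computes_lists fail. Qed.

Lemma computes_shift_coord (n : A -> nat) (d : A -> int) :
  computes n -> computes d -> computes (fun x => shift_coord (n x) (d x)).
Proof. by move=> nP dP; rewrite /shift_coord; computes_lists fail. Qed.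

Lemma computes_words {T : Type} {eT : encoding T} (L : A -> seq T) (m : A -> nat) :
  computes L -> computes m -> computes (fun x => words (L x) (m x)).
Proof.
move=> LP mP; rewrite /words; computes_lists ltac:(idtac; lazymatch goal with
  | |- computes (fun _ => flatten _) => apply computes_flatten end).
Qed.

Lemma computes_window (n : A -> nat) :
  computes n -> computes (fun x => window (n x)).
Proof. by move=> nP; apply: computes_iota0; computes_lists fail. Qed.

Lemma computes_side (n : A -> nat) : computes n -> computes (fun x => side (n x)).
Proof. by move=> nP; rewrite /side; computes_lists fail. Qed.

End ProgramComputability.

Ltac computes_all rules := computes_lists ltac:(idtac; lazymatch goal with
  | |- computes (fun _ => iota 0 _) => apply computes_iota0
  | |- computes (fun _ => bit _ _ _) => apply computes_bit
  | |- computes (fun _ => shift_coord _ _) => apply computes_shift_coord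
  | |- computes (fun _ => words _ _) => apply computes_words
  | |- computes (fun _ => window _) => apply computes_window
  | |- computes (fun _ => side _) => apply computes_side
  | |- _ => rules
  end).

Section AdmissiblePatterns.
Context {A : Type} {eA : encoding A}.

Lemma computes_matrices (m : A -> nat) :
  computes m -> computes (fun x => matrices (m x)).
Proof. by move=> mP; rewrite /matrices; computes_all fail. Qed.

Lemma computes_admissible (x : A -> instance) (n : A -> nat) (M : A -> seq (seq bool)) :
    computes x -> computes n -> computes M ->
  computes (fun z => admissible (x z) (n z) (M z)).
Proof. by move=> xP nP MP; rewrite /admissible; computes_all fail. Qed.

End AdmissiblePatterns.

Section MainProgram.
Context {A : Type} {eA : encoding A}.

Lemma computes_certificate (x : A -> instance) (n : A -> nat) :
  computes x -> computes n -> computes (fun z => certificate (x z) (n z)).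
Proof.
move=> xP nP; rewrite /certificate; computes_all ltac:(idtac; lazymatch goal with
  | |- computes (fun _ => matrices _) => apply computes_matrices
  | |- computes (fun _ => admissible _ _ _) => apply computes_admissible
  end).
Qed.

Lemma computes_blocks (x : A -> instance) (n : A -> nat) :
  computes x -> computes n -> computes (fun z => blocks (x z) (n z)).
Proof.
move=> xP nP; rewrite /blocks /central_block /periodic_matrix.
computes_all ltac:(idtac; lazymatch goal with
  | |- computes (fun _ => matrices _) => apply computes_matrices
  | |- computes (fun _ => admissible _ _ _) => apply computes_admissible
  end).
Qed.

End MainProgram.

Lemma search_program : exists p, forall (x : instance) (n : nat),
    certificate x n -> (forall m, m < n -> ~~ certificate x m) ->
  eval p (encode x) (encode (blocks x n)).
Proof.
have [||p pP] := @computes_while (instance * nat) _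
    (fun z => ~~ certificate z.1 z.2) (fun z => (z.1, z.2.+1)).
- by apply: computes_negb; apply: computes_certificate; computes_all fail.
- by computes_all fail.
have [q qP] : computes (fun z : instance * nat => blocks z.1 z.2).
  by apply: computes_blocks; computes_all fail.
(* The loop starts at [n = 0], whose code is [Leaf]. *)
exists (PSeq (PNode PId PLeaf) (PSeq p q)) => x n cn cm.
have iE k : iter k (fun z : instance * nat => (z.1, z.2.+1)) (x, 0%N) = (x, k).
  by elim: k => //= k ->.
apply: ESeq; first by apply: ENode; [exact: EId | exact: ELeaf].
apply: ESeq; last exact: (qP (x, n)).
rewrite -iE; apply: (pP (x, 0%N)) => [i i_n|]; rewrite iE ?negbK //=.
exact: cm.
Qed.

(** * Correctness and termination of the search *)

Lemma mem_words (T : eqType) (L : seq T) m w :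
  (w \in words L m) = (size w == m) && all (mem L) w.
Proof.
elim: m w => [|m IHm] w.
  by rewrite /words /= inE; case: w.
rewrite /words iterS -/(words L m); apply/flatten_mapP/idP => [[t tL]|].
  by move=> /mapP[v + ->] /=; rewrite IHm tL eqSS.
case: w => // t v /=; rewrite eqSS => /and3P[sv tL vL]; exists t => //.
by apply: map_f; rewrite IHm sv.
Qed.

Definition tabulate (T : Type) (m k : nat) (f : nat -> nat -> T) : seq (seq T) :=
  [seq [seq f i j | j <- iota 0 k] | i <- iota 0 m].

Lemma nth_tabulate (T : Type) (t0 : T) m k f i j : i < m -> j < k ->
  nth t0 (nth [::] (tabulate m k f) i) j = f i j.
Proof.
move=> im jk; rewrite (nth_map 0) ?size_iota // (nth_map 0) ?size_iota //.
by rewrite !nth_iota.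
Qed.

Lemma tabulate_matrices m f : tabulate m m f \in matrices m.
Proof.
rewrite mem_words size_map size_iota eqxx /=.
apply/allP => _ /mapP[i _ ->] /=; rewrite mem_words size_map size_iota eqxx /=.
by apply/allP => -[] _.
Qed.

Local Open Scope ring_scope.

Lemma shift_coordE n d : (`|d| <= n)%N -> (shift_coord n d)%:Z = n%:Z + d.
Proof. by rewrite /shift_coord; case: ifP; lia. Qed.

Definition covers_at (s : seq (int * int)) (b a : nat) (c : configuration) u :=
  count (fun d => c (u + d)) s = if c u then b else a.

Lemma eq_covers_at s b a c c' u u' :
    (forall d, d \in s -> c (u + d) = c' (u' + d)) -> c u = c' u' ->
  covers_at s b a c u <-> covers_at s b a c' u'.
Proof. by move=> cc' cu; rewrite /covers_at (eq_in_count cc') cu. Qed.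

Definition pattern (c : configuration) (w : int * int) (n : nat) :=
  tabulate (side n) (side n)
    (fun i j => c (w.1 + i%:Z - (n + n + n)%:Z, w.2 + j%:Z - (n + n + n)%:Z)).

Section Certificate.
Variables (s : seq (int * int)) (b a n : nat).
Let x : instance := (s, (b, a)).
Hypothesis sn : forall d, d \in s -> (`|d.1| <= n)%N /\ (`|d.2| <= n)%N.

Lemma bit_pattern c w i j : (i < side n)%N -> (j < side n)%N ->
  bit (pattern c w n) i j =
    c (w.1 + i%:Z - (n + n + n)%:Z, w.2 + j%:Z - (n + n + n)%:Z).
Proof. exact: nth_tabulate. Qed.

Lemma window_side i d : (i < (n + n + n + n).+1)%N -> (`|d| <= n)%N ->
  (i + shift_coord n d < side n)%N.
Proof. by move=> iw dn; have := shift_coordE dn; rewrite /side; lia. Qed.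

Lemma admissible_pattern c w :
  (forall u, covers_at s b a c u) -> admissible x n (pattern c w n).
Proof.
move=> cov; apply/allP => i; rewrite mem_iota add0n => /andP[_ iw].
apply/allP => j; rewrite mem_iota add0n => /andP[_ jw]; apply/eqP.
(* Window index [i] is matrix index [i + n], that is, the coordinate [w.1 + i - 2n]. *)
have := cov (w.1 + i%:Z - (n + n)%:Z, w.2 + j%:Z - (n + n)%:Z).
rewrite /covers_at bit_pattern ?/side; [|lia|lia].
move=> covw; transitivity (count (fun d => c
    ((w.1 + i%:Z - (n + n)%:Z, w.2 + j%:Z - (n + n)%:Z) + d)) s).
  apply: eq_in_count => d /sn[d1 d2].
  rewrite bit_pattern; try exact: window_side.
  by congr (c (_, _)); rewrite PoszD shift_coordE //=; lia.
rewrite covw; congr (if c (_, _) then _ else _); lia.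
Qed.

Lemma periodic_mod (f : nat -> bool) m : (0 < n)%N ->
    (forall i, (i < m - n)%N -> f i = f (i + n)%N) ->
  forall i, (i < m)%N -> f i = f (i %% n)%N.
Proof.
move=> n0 fn; elim/ltn_ind=> i IHi im; have [i_n|n_i] := ltnP i n.
  by rewrite modn_small.
rewrite -{1}(subnK n_i) -fn; last by lia.
rewrite IHi; [|lia|lia].
by rewrite -{2}(subnK n_i) modnDr.
Qed.

Lemma periodic_matrix_mod M i j : (0 < n)%N -> periodic_matrix n M ->
    (i < side n)%N -> (j < side n)%N ->
  bit M i j = bit M (i %% n) (j %% n).
Proof.
move=> n0 /allP pM im jm.
have pMij k l : (k < side n - n)%N -> (l < side n)%N ->
    bit M k l = bit M (k + n) l /\ bit M l k = bit M l (k + n).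
  move=> kn ln; have := pM k; rewrite mem_iota kn => /(_ isT)/allP/(_ l).
  by rewrite mem_iota ln => /(_ isT)/andP[/eqP ? /eqP ?].
rewrite (@periodic_mod (fun k => bit M k j) (side n)) //; last first.
  by move=> k kn; have [] := pMij k j kn jm.
apply: (@periodic_mod (fun k => bit M _ k) (side n)) => // k kn.
have [] := pMij k (i %% n)%N kn => //.
by apply: leq_trans (ltn_pmod _ n0) _; rewrite /side; lia.
Qed.

Lemma modz_mod (k : nat) (m : int) : (0 < n)%N -> (n%:Z %| k%:Z - m)%Z ->
  (k %% n)%N = `|(m %% n)%Z|%N.
Proof.
move=> n0 /dvdzP[q qE].
have -> : m = k%:Z + (- q) * n%:Z by rewrite mulNr -qE; ring.
by rewrite addrC modzMDl modz_nat.
Qed.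

Lemma absz_modz_lt k : (0 < n)%N -> (`|(k %% n)%Z| < n)%N.
Proof.
move=> n0; have nz : n%:Z != 0 by lia.
by have := modz_ge0 k nz; have := ltz_pmod k (_ : 0 < n%:Z); lia.
Qed.

Lemma periodic_central_block M u : (0 < n)%N ->
  periodic_configuration (central_block n M) u =
  bit M (`|(u.1 %% n)%Z| + (n + n + n)) (`|(u.2 %% n)%Z| + (n + n + n)).
Proof.
move=> n0; have nz : (n%:Z != 0) by lia.
have lt k := absz_modz_lt k n0.
rewrite /periodic_configuration.
rewrite [size (central_block n M)]size_map size_iota.
have -> : size (nth [::] (central_block n M) `|(u.1 %% n)%Z|%N) = n.
  by rewrite (nth_map 0%N) ?size_iota // size_map size_iota.
by rewrite /central_block (nth_tabulate _ (fun i j => bit M (i + _) (j + _))).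
Qed.

(** Every point is congruent modulo [n] to one of the window, and [D] stays within distance [n], so
    each test on the periodic extension is one of the tests made on [M]. *)
Lemma block_covering M : (0 < n)%N -> admissible x n M -> periodic_matrix n M ->
  forall u, covers_at s b a (periodic_configuration (central_block n M)) u.
Proof.
move=> n0 adM pM u.
have nz : (n%:Z != 0) by lia.
have lt k := absz_modz_lt k n0.
have cE v : periodic_configuration (central_block n M) v =
    bit M `|(v.1 %% n)%Z| `|(v.2 %% n)%Z|.
  have := (lt v.1, lt v.2); move=> [l1 l2].
  rewrite periodic_central_block // periodic_matrix_mod ?/side; try lia.
  by congr bit; rewrite !addnA !modnDr modn_small.
pose i := (`|(u.1 %% n)%Z| + (n + n))%N; pose j := (`|(u.2 %% n)%Z| + (n + n))%N.
have iw : (i < (n + n + n + n).+1)%N by have := lt u.1; rewrite /i; lia.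
have jw : (j < (n + n + n + n).+1)%N by have := lt u.2; rewrite /j; lia.
have /allP/(_ i) := adM; rewrite mem_iota iw => /(_ isT)/allP/(_ j).
rewrite mem_iota jw => /(_ isT)/eqP covM; rewrite /covers_at.
transitivity (count (fun d => bit M (i + shift_coord n d.1) (j + shift_coord n d.2)) s).
  apply: eq_in_count => d /sn[d1 d2]; rewrite cE [RHS]periodic_matrix_mod //.
  - congr bit; symmetry; apply: modz_mod => //; rewrite PoszD shift_coordE //.
      rewrite /i !PoszD gez0_abs ?modz_ge0 // -[(u + d).1]/(u.1 + d.1).
      (* The row index is the residue of [u.1] plus [3n + d.1]; it exceeds [u.1 + d.1] by [3n] minus
         [n] times the quotient of [u.1] by [n]. *)
      apply/dvdzP; exists (3 - (u.1 %/ n)%Z); have := divz_eq u.1 n.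
      by move: u.1 (u.1 %/ n)%Z (u.1 %% n)%Z => t q r ->; ring.
    rewrite /j !PoszD gez0_abs ?modz_ge0 // -[(u + d).2]/(u.2 + d.2).
      apply/dvdzP; exists (3 - (u.2 %/ n)%Z); have := divz_eq u.2 n.
      by move: u.2 (u.2 %/ n)%Z (u.2 %% n)%Z => t q r ->; ring.
  - exact: window_side.
  - exact: window_side.
rewrite covM cE [in LHS]periodic_matrix_mod //; first last.
- by rewrite /side; lia.
- by rewrite /side; lia.
by rewrite /i /j !addnA !modnDr !modn_small.
Qed.

End Certificate.

Lemma periodic_modz (T : Type) (f : int -> T) (n : nat) t :
  (forall t, f t = f (t + n%:Z)) -> f t = f (t %% n)%Z.
Proof.
move=> fn; have fk (k : nat) t' : f t' = f (t' + k%:Z * n%:Z).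
  elim: k => [|k IHk]; first by rewrite mul0r addr0.
  by rewrite IHk fn; congr f; rewrite -addn1 PoszD; ring.
rewrite {1}(divz_eq t n); case: (t %/ n)%Z => k; first by rewrite addrC -fk.
by rewrite (fk k.+1) NegzE; congr f; ring.
Qed.

(** The certificate is applied to the pattern of [c] centred at [w]. *)
Lemma certificate_period s b a n c w :
    certificate (s, (b, a)) n -> (forall u, covers_at s b a c u) ->
  c w = c (w.1 + n%:Z, w.2) /\ c w = c (w.1, w.2 + n%:Z).
Proof.
move=> /and3P[n0 /allP sn /allP cert] cov.
have sn' d : d \in s -> (`|d.1| <= n)%N /\ (`|d.2| <= n)%N.
  by move=> /sn/andP.
have := cert (pattern c w n) (tabulate_matrices _ _).
rewrite (admissible_pattern sn' w cov) implyTb.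
rewrite !bit_pattern ?/side; try lia.
rewrite -!addrA !PoszD; move=> /andP[/eqP c1 /eqP c2]; move: c1 c2.
rewrite !subrr !addr0 -surjective_pairing => c1 c2; split.
  by rewrite c1; congr (c (_, _)); ring.
by rewrite c2; congr (c (_, _)); ring.
Qed.

(** A covering has period [n] in both directions, so its pattern about the origin passes both tests
    of [blocks], and the central block repeats to the covering. The converse inclusion is
    [block_covering]. *)
Lemma certificate_sound (D : {fset int * int}) s b a n :
    perm_eq s D -> certificate (s, (b, a)) n ->
  all is_block (blocks (s, (b, a)) n) /\
  coverings D b a =
    [set periodic_configuration B | B in [set` blocks (s, (b, a)) n]]%classic.
Proof.
move=> sD cert; have /and3P[n0 /allP sn _] := cert.
have {n0} n0 : (0 < n)%N by rewrite lt0n.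
have sn' d : d \in s -> (`|d.1| <= n)%N /\ (`|d.2| <= n)%N.
  by move=> /sn/andP.
split.
  apply/allP => _ /mapP[M _ ->]; apply/and3P; split.
  - by case: (n) n0.
  - by case: (n) n0 => // k _.
  rewrite /central_block; apply/allP => r /mapP[i _ ->].
  by case: (n) n0 => // k _; rewrite /= !size_map !size_iota.
rewrite seteqP; split=> [c /(is_coveringP _ _ _ sD) cov|_ [B /mapP[M + ->] <-]];
    last first.
  rewrite mem_filter => /andP[/andP[adM pM] _].
  exact/(is_coveringP _ _ _ sD)/(block_covering sn' n0 adM pM).
have per w := certificate_period w cert cov.
pose M := pattern c (0, 0) n.
have bitM i j : (i < side n)%N -> (j < side n)%N ->
    bit M i j = c (i%:Z - (n + n + n)%:Z, j%:Z - (n + n + n)%:Z).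
  by move=> im jm; rewrite bit_pattern // !add0r.
exists (central_block n M).
  apply/mapP; exists M => //; rewrite mem_filter tabulate_matrices andbT.
  rewrite (admissible_pattern sn' _ cov); apply/allP => i.
  rewrite mem_iota add0n => /andP[_ im]; apply/allP => j.
  rewrite mem_iota add0n => /andP[_ jm].
  rewrite !bitM ?/side; try (move: im jm; rewrite /side; lia).
  apply/andP; split; apply/eqP.
    by rewrite (per _).1; congr (c (_, _)); rewrite /= PoszD; ring.
  by rewrite (per _).2; congr (c (_, _)); rewrite /= PoszD; ring.
apply/funext => u; rewrite periodic_central_block //.
have nz : (n%:Z != 0) by lia.
have lt k := absz_modz_lt k n0.
have [l1 l2] := (lt u.1, lt u.2).
rewrite bitM ?/side; try lia.
rewrite !(PoszD (absz _)) !addrK !gez0_abs ?modz_ge0 //.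
rewrite [in RHS](surjective_pairing u).
rewrite [RHS](periodic_modz (f := fun t => c (t, u.2)) (n := n)); last first.
  by move=> t; rewrite (per _).1.
rewrite [RHS](periodic_modz (f := fun t => c (_, t)) (n := n)) //.
by move=> t; rewrite (per _).2.
Qed.

(** * Common periods and compactness *)

Lemma covers_at_shift s b a c t u :
  covers_at s b a (fun v => c (v + t)) u <-> covers_at s b a c (u + t).
Proof. by apply: eq_covers_at => [d _|//]; rewrite addrAC. Qed.

(** Among [K + 1] successive translates of a covering by [t], two agree on [S] and hence everywhere.
    Their indices differ by at most [K], so the difference divides the factorial of [K], which thus
    serves all coverings. *)
Lemma uniform_period (R : realType) (D : {fset int * int}) (b a : nat)
    (t : int * int) :
    ~ has_line_factor (gpoly R D b a) ->
  exists2 p, (0 < p)%N & forall c q, is_covering D b a c -> (p %| q)%N ->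
    forall u, c (u + t *+ q) = c u.
Proof.
move=> /coverings_determined[S SP]; set K := #|{: (size S).-tuple bool}|.
exists K`! => [|c q cov pq u]; first exact: fact_gt0.
pose h (i : 'I_K.+1) : (size S).-tuple bool :=
  map_tuple (fun v => c (v + t *+ i)) (in_tuple S).
have /injectivePn[i [j ij hij]] : ~~ injectiveb h.
  apply/negP => /injectiveP/leq_card; rewrite card_ord /K ltnn.
  by [].
wlog {ij} ij : i j hij / (i < j)%N.
  move=> W; have [lij|lji|eij] := ltngtP i j; first exact: (W i j).
    exact: (W j i).
  by case/eqP: ij; apply: val_inj.
have covs (k : nat) : is_covering D b a (fun v => c (v + t *+ k)).
  have sD := perm_refl D.
  apply/(is_coveringP _ _ _ sD) => v; apply/covers_at_shift.
  exact: ((is_coveringP _ _ _ sD).1 cov).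
have cij : (fun v => c (v + t *+ i)) = (fun v => c (v + t *+ j)).
  apply: SP => // w wS.
  by have /(congr1 val)/eq_in_map/(_ w wS) := hij.
have cd v : c (v + t *+ (j - i)) = c v.
  have := congr1 (fun f => f (v - t *+ i)) cij; rewrite subrK => ->.
  by rewrite -addrA [- _ + _]addrC mulrnBr // ltnW.
have : (j - i %| q)%N.
  by apply: dvdn_trans pq; rewrite dvdn_fact // subn_gt0 ij /=; have := ltn_ord j; lia.
case/dvdnP => m ->; elim: m u => [|m IHm] u; first by rewrite mulr0n addr0.
by rewrite mulSn mulrnDr addrA IHm cd.
Qed.

(** Otherwise there are counterexamples [C N] for all [N]. An ultralimit [c] of them satisfies every
    covering condition, as each involves finitely many points, so [P c] holds; but some [C n] agrees
    with [c] on [W], a contradiction. *)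
Lemma compactness (s : seq (int * int)) (b a : nat) (P : configuration -> Prop)
    (W : seq (int * int)) :
    (forall c c', (forall w, w \in W -> c w = c' w) -> P c -> P c') ->
    (forall c, (forall u, covers_at s b a c u) -> P c) ->
  exists N : nat, forall c,
    (forall u, (`|u.1| <= N)%N -> (`|u.2| <= N)%N -> covers_at s b a c u) -> P c.
Proof.
move=> PW covP; apply: contrapT => /forallNP noN.
have /choice[C CP] : forall N : nat, exists c, (forall u, (`|u.1| <= N)%N ->
    (`|u.2| <= N)%N -> covers_at s b a c u) /\ ~ P c.
  by move=> N; have /existsNP[c /not_implyP[cov nP]] := noN N; exists c.
(* The filter of cofinite sets of indices. *)
pose F : set_system nat :=
  [set A | exists N, forall n, (N <= n)%N -> A n]%classic.
have PF : ProperFilter F.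
  apply: Build_ProperFilter_ex => [A [N NA]|]; first by exists N; apply: NA.
  split=> [|A B [N NA] [N' NB]|A B AB [N NA]]; first by exists 0%N.
    by exists (maxn N N') => n; rewrite geq_max => /andP[/NA ? /NB ?].
  by exists N => n /NA/AB.
have [U [UU FU]] := ultraFilterLemma PF.
have UP : ProperFilter U by case: UU.
(* The pointwise limit of the [C n] along the ultrafilter [U]. *)
pose c u := `[< U [set n | C n u]%classic >].
have cU u : U [set n | C n u = c u]%classic.
  rewrite /c; case: asboolP => [//|nU].
  have [//|] := in_ultra_setVsetC [set n | C n u]%classic UU.
  by apply: filterS => n /= /negP/negbTE.
have cUs (l : seq (int * int)) : U [set n | forall w, w \in l -> C n w = c w]%classic.
  elim: l => [|u l IHl]; first exact: filterS filterT.
  apply: filterS (filterI (cU u) IHl) => n [/= Cu Cl] w.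
  by rewrite inE => /orP[/eqP->|/Cl].
suff Pc : P c.
  have [n /= nW] := filter_ex (cUs W); have [_] := CP n; apply.
  by apply: PW Pc => w /nW.
apply: covP => u.
have Uu : U [set n | (`|u.1| + `|u.2| <= n)%N]%classic.
  by apply: FU; exists (`|u.1| + `|u.2|)%N.
(* Some [n] is so large that [u] lies in its square, while [C n] agrees with [c] at [u] and at all
   [u + d]. *)
have [n /= [Cn un]] := filter_ex (filterI (cUs (u :: [seq u + d | d <- s])) Uu).
have [covn _] := CP n; apply/(@eq_covers_at s b a (C n) c u u).
- by move=> d ds; apply: Cn; rewrite inE map_f ?orbT.
- by apply: Cn; rewrite mem_head.
by apply: covn; lia.
Qed.

Lemma absz_shift_coord n (v t : int) : (`|v| <= n + n)%N -> (`|t| <= n)%N ->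
  absz (v + t + (n + n + n)%:Z)%R = (absz (v + (n + n)%:Z)%R + shift_coord n t)%N.
Proof. by move=> vn tn; have := shift_coordE tn; lia. Qed.

Lemma admissible_covers s b a n M u :
    (forall d, d \in s -> (`|d.1| <= n)%N /\ (`|d.2| <= n)%N) ->
    admissible (s, (b, a)) n M ->
    (`|u.1| <= n + n)%N -> (`|u.2| <= n + n)%N ->
  covers_at s b a (fun v => bit M `|v.1 + (n + n + n)%:Z| `|v.2 + (n + n + n)%:Z|) u.
Proof.
move=> sn /allP adM u1 u2.
have := adM (absz (u.1 + (n + n)%:Z)); rewrite mem_iota => /(_ _)/allP adMi.
have {adMi} := adMi _ (absz (u.2 + (n + n)%:Z)); rewrite mem_iota => adMij.
have {adMij} /eqP cov := adMij ltac:(lia) ltac:(lia).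
rewrite /covers_at; transitivity (if bit M (`|(u.1 + (n + n)%:Z)%R| + n)
    (`|(u.2 + (n + n)%:Z)%R| + n) then b else a).
  rewrite -[RHS]cov; apply: eq_in_count => d /sn[d1 d2].
  rewrite -[(u + d).1]/(u.1 + d.1) -[(u + d).2]/(u.2 + d.2).
  by congr bit; apply: absz_shift_coord.
have absE v : (`|v| <= n + n)%N ->
    (absz (v + (n + n)%:Z)%R + n)%N = absz (v + (n + n + n)%:Z)%R by lia.
by rewrite !absE.
Qed.

(** Once a square of radius [N] forces the common period [r] at its centre, a larger square forces
    it along [k] successive steps on either axis, which joins the origin to the points at distance
    [n = r k]. *)
Lemma certificate_exists (R : realType) (D : {fset int * int}) s (b a : nat) :
    perm_eq s D -> ~ has_line_factor (gpoly R D b a) ->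
  exists n, certificate (s, (b, a)) n.
Proof.
move=> sD nlf.
have [p p0 perp] := uniform_period (1, 0) nlf.
have [q q0 perq] := uniform_period (0, 1) nlf.
pose r := (p * q)%N; have r0 : (0 < r)%N by rewrite muln_gt0 p0.
have rE (k : nat) : (1, 0) *+ k = (k%:Z, 0) :> (int * int)%type /\
    (0, 1) *+ k = (0, k%:Z) :> (int * int)%type.
  elim: k => [//|k [IH1 IH2]]; rewrite !mulrS IH1 IH2; split;
  by rewrite -[LHS]/(_ + _, _ + _) /= ?addr0.
have [||N NP] := @compactness s b a
    (fun c => c 0 = c (r%:Z, 0) /\ c 0 = c (0, r%:Z))
    [:: 0; (r%:Z, 0); (0, r%:Z)].
- by move=> c c' cc'; rewrite !cc' // !inE eqxx ?orbT.
- move=> c /(is_coveringP _ _ _ sD) cov.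
  have := (perp c r cov (dvdn_mulr q (dvdnn p)) 0, perq c r cov (dvdn_mull p (dvdnn q)) 0).
  by rewrite !add0r (rE r).1 (rE r).2 => -[-> ->].
pose M := \max_(d <- s) maxn `|d.1| `|d.2|.
(* [k] exceeds both [N] and the extent [M] of [D]. Since [n >= k], the squares of radius [N] about
   points of [[-n, n]^2] stay inside [[-2n, 2n]^2], where the covering condition is tested. *)
pose k := (N + M).+1; pose n := (r * k)%N.
have kn : (k <= n)%N by rewrite leq_pmull.
have sn d : d \in s -> (`|d.1| <= n)%N /\ (`|d.2| <= n)%N.
  move=> ds; apply/andP; rewrite -geq_max.
  apply: (@leq_trans M); last by move: kn; rewrite /k; lia.
  exact: (leq_bigmax_seq (F := fun d => maxn `|d.1| `|d.2|)).
exists n; apply/and3P; split.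
- by rewrite -lt0n; lia.
- by apply/allP => d /sn/andP.
apply/allP => A _; apply/implyP => adA.
pose c : configuration := fun v =>
  bit A `|v.1 + (n + n + n)%:Z| `|v.2 + (n + n + n)%:Z|.
have cov := admissible_covers sn adA; rewrite -/c in cov.
have step t : (`|t.1| <= n)%N -> (`|t.2| <= n)%N ->
    c t = c (t + (r%:Z, 0)) /\ c t = c (t + (0, r%:Z)).
  move=> t1 t2; have := NP (fun v => c (v + t)).
  rewrite add0r ![_ + t]addrC; apply => u u1 u2; apply/covers_at_shift.
  by apply: cov; rewrite -?[(u + t).1]/(u.1 + t.1) -?[(u + t).2]/(u.2 + t.2); lia.
have walk1 i : (i <= k)%N -> c 0 = c ((r * i)%:Z, 0).
  elim: i => [|i IHi] ik; first by rewrite muln0.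
  rewrite IHi ?(ltnW ik) //; have [|//|-> _] := step ((r * i)%:Z, 0).
    by rewrite /= leq_mul2l (ltnW ik) orbT.
  by congr (c (_, _)); rewrite /= ?addr0 // mulnS addnC PoszD.
have walk2 i : (i <= k)%N -> c 0 = c (0, (r * i)%:Z).
  elim: i => [|i IHi] ik; first by rewrite muln0.
  rewrite IHi ?(ltnW ik) //; have [//||_ ->] := step (0, (r * i)%:Z).
    by rewrite /= leq_mul2l (ltnW ik) orbT.
  by congr (c (_, _)); rewrite /= ?addr0 // mulnS addnC PoszD.
have cbit (i j : nat) : c (i%:Z, j%:Z) = bit A (n + n + n + i) (n + n + n + j).
  by rewrite /c /=; congr bit; lia.
have c0 : c 0 = bit A (n + n + n) (n + n + n).
  by rewrite -[0]/(0%:Z, 0%:Z) cbit !addn0.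
have c1 := walk1 k (leqnn _); have c2 := walk2 k (leqnn _).
rewrite c0 -/n cbit addn0 in c1; rewrite c0 -/n cbit addn0 in c2.
by rewrite -c1 -c2 eqxx.
Qed.

Theorem theorem27 (R : realType) :
  (forall (D : {fset int * int}) (b a : nat),
     ~ has_line_factor (gpoly R D b a) -> finite_set (coverings D b a)) /\
  coverings_effectively_constructible
    (fun D b a => ~ has_line_factor (gpoly R D b a)).
Proof.
split=> [D b a|]; first exact: finite_coverings.
have [p pP] := search_program; exists p => D b a nlf s sD.
(* The search tries [n] in increasing order, so it stops at the least certificate. *)
have [n cn n_min] := ex_minnP (certificate_exists sD nlf).
have [blocksP covE] := certificate_sound sD cn.
exists (blocks (s, (b, a)) n); split=> //; apply: (pP (s, (b, a))) => // m mn.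
by apply: contraL mn => /n_min; rewrite -leqNgt.
Qed.
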